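(* Let $(\Omega,\mathcal{B},\mu)$ be a $\sigma$-finite measure space, let $H$ be a Hilbert space and fix $p \in (1,\infty)$. Define \[ C = \{ u \in L_2(\Omega,H) \cap L_p(\Omega,H) : \|u\|_{L_p(\Omega,H)} \leq 1 \}, \] and let $P$ be the orthogonal projection of $L_2(\Omega,H)$ onto the closed convex set $C$. Let $\mathcal{V}$ be a Hilbert space which is continuously and densely embedded in $L_2(\Omega,H)$. Let $\mathfrak{a} \colon \mathcal{V} \times \mathcal{V} \to \mathbb{C}$ be a continuous elliptic sesquilinear form, let $A$ be the operator in $L_2(\Omega,H)$ associated with $\mathfrak{a}$ and let $S = (S_t)_{t>0}$ be the semigroup generated by $-A$. Then the following are equivalent. (i) $\|S_t u\|_{L_p(\Omega,H)} \leq \|u\|_{L_p(\Omega,H)}$ for all $u \in L_2(\Omega,H) \cap L_p(\Omega,H)$ and $t > 0$. (ii) $P \mathcal{V} \subset \mathcal{V}$ and $\operatorname{Re} \mathfrak{a}(u, \|u\|_H^{p-1} \operatorname{sgn} u) \geq 0$ for all $u \in \mathcal{V}$ with $\|u\|_H^{p-1} \operatorname{sgn} u \in \mathcal{V}$.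
   Context: Hilbert spaces are complex, and $L_p(\Omega,H)$ denotes the Bochner space. For a function $u \colon \Omega \to H$, $\|u\|_H \colon \Omega \to \mathbb{R}$ is the function $\|u\|_H(x) = \|u(x)\|_H$, and $\operatorname{sgn} u \colon \Omega \to H$ is defined by $(\operatorname{sgn} u)(x) = \frac{1}{\|u(x)\|_H} u(x)$ if $u(x) \neq 0$ and $(\operatorname{sgn} u)(x) = 0$ if $u(x) = 0$. The orthogonal projection onto the closed convex set $C$ is the map assigning to each $f \in L_2(\Omega,H)$ the unique element of $C$ closest to $f$ in the norm of $L_2(\Omega,H)$. The sesquilinear form $\mathfrak{a}$ is continuous if there is an $M > 0$ such that $|\mathfrak{a}(u,v)| \leq M \|u\|_{\mathcal{V}} \|v\|_{\mathcal{V}}$ for all $u,v \in \mathcal{V}$. It is elliptic if there are $\kappa > 0$ and $\omega \in \mathbb{R}$ such that $\operatorname{Re} \mathfrak{a}(u,u) + \omega \|u\|_{L_2(\Omega,H)}^2 \geq \kappa \|u\|_{\mathcal{V}}^2$ for all $u \in \mathcal{V}$. The operator $A$ associated with $\mathfrak{a}$ is the operator in $L_2(\Omega,H)$ with graph \[ \{ (u,f) : u \in \mathcal{V},\ f \in L_2(\Omega,H) \text{ and } \mathfrak{a}(u,v) = (f,v)_{L_2(\Omega,H)} \text{ for all } v \in \mathcal{V} \}. \] Then $-A$ generates a holomorphic $C_0$-semigroup $(S_t)_{t>0}$ on $L_2(\Omega,H)$. *)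

(* Defs.v *)
From HB Require Import structures.
From mathcomp Require Import all_boot all_order all_algebra complex.
From mathcomp Require Import generic_quotient ring_quotient sesquilinear.
From mathcomp Require Import all_classical all_reals all_analysis.
From mathcomp Require Import measurable_realfun.

Set Implicit Arguments.
Unset Strict Implicit.
Unset Printing Implicit Defensive.

Import Order.TTheory GRing.Theory Num.Theory Num.Def.
Import numFieldNormedType.Exports.
Local Open Scope classical_set_scope.
Local Open Scope complex_scope.
Local Open Scope ring_scope.

HB.mixin Record isHilbert (R : realType) H & CompleteNormedModule R[i] H := {
  inner : {dot H for (@conjC R[i])} ;
  normr_inner : forall x : H, `|x| ^+ 2 = inner x x
}.

#[short(type="hilbertType")]
HB.structure Definition Hilbert (R : realType) :=
  { H of CompleteNormedModule R[i] H & isHilbert R H }.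

(* The norm of a module over R[i] takes its values in R[i]; this is the same
   norm as a real number. *)
Definition rnorm (R : realType) (V : normedModType R[i]) (x : V) : R :=
  complex.Re `|x|.

Section rnorm_theory.
Context (R : realType) (V : normedModType R[i]).
Implicit Types (x y : V) (a : R[i]).

Lemma rnormE x : (rnorm x)%:C = `|x|.
Proof. by rewrite /rnorm RRe_real// normr_real. Qed.

Lemma rnorm_ge0 x : 0 <= rnorm x.
Proof. by rewrite -ler0c rnormE. Qed.

Lemma ler_rnormD x y : rnorm (x + y) <= rnorm x + rnorm y.
Proof. by rewrite -lecR rmorphD/= !rnormE ler_normD. Qed.

Lemma rnormZ a x : rnorm (a *: x) = complex.Re `|a| * rnorm x.
Proof.
apply: (@complexI R); rewrite rnormE normrZ -(rnormE x).
by rewrite -{1}[`|a|]RRe_real ?normr_real// -rmorphM.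
Qed.

Lemma rnorm0 : rnorm (0 : V) = 0.
Proof. by apply: (@complexI R); rewrite rnormE normr0. Qed.

Lemma rnorm0_eq0 x : rnorm x = 0 -> x = 0.
Proof. by move=> x0; apply/normr0_eq0; rewrite -rnormE x0. Qed.

Lemma cvg_rnorm (s : nat -> V) x :
  s @ \oo --> x -> (fun n => rnorm (s n)) @ \oo --> rnorm x.
Proof.
move=> sx; apply/cvgrPdist_lt => e e0.
have e0' : 0 < e%:C :> R[i] by rewrite ltcR.
have /cvgrPdist_lt/(_ _ e0') := sx; apply: filterS => n.
move=> h; rewrite -ltcR; apply: le_lt_trans h.
have := ler_dist_dist x (s n); apply: le_trans.
rewrite -[in leRHS](rnormE x) -(rnormE (s n)) -rmorphB.
by rewrite normc_def/= expr0n/= addr0 sqrtr_sqr.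
Qed.

End rnorm_theory.

Section bochner_functions.
Context d (T : measurableType d) (R : realType) (H : normedModType R[i]).
Implicit Types u v : T -> H.

Definition normf u : T -> R := fun x => rnorm (u x).

(* Everywhere limits of simple functions: every almost everywhere limit of
   simple functions has such a representative, so the quotient below by
   equality almost everywhere is the usual one. *)
Definition strongly_measurable u :=
  exists s : nat -> {fimfun T >-> H},
    (forall n y, measurable (s n @^-1` [set y])) /\
    (forall x, s n x @[n --> \oo] --> u x).

Lemma strongly_measurable0 : strongly_measurable 0.
Proof.
exists (fun=> 0); split => [n y|x]; last exact: cvg_cst.
have [->|y0] := eqVneq y 0.
  by rewrite (_ : _ @^-1` _ = setT)//; apply/seteqP; split.
rewrite (_ : _ @^-1` _ = set0)//; apply/seteqP; split => // x /= y0'.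
by rewrite -y0' eqxx in y0.
Qed.

Lemma strongly_measurableP (a : R[i]) u v :
  strongly_measurable u -> strongly_measurable v ->
  strongly_measurable (a *: u + v).
Proof.
move=> [s [ms su]] [t [mt tv]].
have fst n : finite_set (range (a *: (s n : T -> H) + (t n : T -> H))).
  have := finite_image2 (fun y z : H => a *: y + z)
    (@fimfunP _ _ (s n)) (@fimfunP _ _ (t n)).
  by apply: sub_finite_set => _ [x _ <-] /=; exists (s n x); [exists x|exists (t n x) => //; exists x].
pose w n : {fimfun T >-> H} :=
  FImFun.Pack (FImFun.Class (FiniteImage.Build _ _ _ (fst n))).
exists w; split=> [n y|x]; last first.
  by apply: cvgD; [apply: cvgZl_tmp; exact: su|exact: tv].
rewrite (_ : _ @^-1` _ = \bigcup_(z in range (s n))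
    (s n @^-1` [set z] `&` t n @^-1` [set y - a *: z])).
  apply: fin_bigcup_measurable; first exact: fimfunP.
  by move=> z _; exact: measurableI.
apply/seteqP; split => [x /= <-|x [z _ /= [sz tz]]].
  exists (s n x); first by exists x.
  by split => //=; rewrite addrAC subrr add0r.
rewrite -[LHS]/(a *: s n x + t n x) sz tz addrC subrK//.
Qed.

Lemma measurable_normf u :
  strongly_measurable u -> measurable_fun setT (normf u).
Proof.
move=> [s [ms su]].
apply: (@measurable_fun_cvg _ _ _ _ (fun n x => rnorm (s n x))) => //; last first.
  by move=> x _; apply: cvg_rnorm; exact: su.
move=> n _ Y mY; rewrite setTI.
rewrite (_ : _ @^-1` _ =
    \bigcup_(z in range (s n) `&` [set z | Y (rnorm z)]) s n @^-1` [set z]).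
  apply: fin_bigcup_measurable; last by move=> z _; exact: ms.
  by apply: finite_setIl; exact: fimfunP.
apply/seteqP; split => [x /= Yx|x [z [_ /= Yz] /= ->//]].
by exists (s n x) => //; split => //; exists x.
Qed.

End bochner_functions.

Section bochner_norm.
Context d (T : measurableType d) (R : realType).
Variables (mu : {measure set T -> \bar R}) (H : normedModType R[i]) (p : R).
Implicit Types u v : T -> H.

Definition bochner_norm u : \bar R := 'N[mu]_p%:E[EFin \o normf u]%E.

Hypothesis p1 : 1 <= p.

Let p_gt0 : 0 < p. Proof. exact: lt_le_trans p1. Qed.

Let measurable_normf_poweR u : strongly_measurable u ->
  measurable_fun setT (fun x => (`|(normf u x)%:E| `^ p)%E).
Proof.
move=> su; apply: measurableT_comp (measurable_poweR p) _.
apply: measurableT_comp => //; apply/measurable_EFinP.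
exact: measurable_normf.
Qed.

Lemma bochner_norm0 : bochner_norm 0 = 0%E.
Proof.
rewrite /bochner_norm (_ : EFin \o _ = cst 0%E).
  by rewrite Lnorm0// eqe gt_eqF.
by apply/funext => x; rewrite /= /normf rnorm0.
Qed.

Lemma ler_bochner_normD u v : strongly_measurable u -> strongly_measurable v ->
  (bochner_norm (u + v)%R <= bochner_norm u + bochner_norm v)%E.
Proof.
move=> su sv.
have suv : strongly_measurable (u + v).
  by rewrite -[u]scale1r; exact: strongly_measurableP.
have := minkowski_EFin mu (measurable_normf su) (measurable_normf sv) p1.
apply: le_trans; rewrite /bochner_norm unlock.
apply: gt0_ler_poweR; rewrite ?invr_ge0 ?(ltW p_gt0)//.
- rewrite in_itv/= leey andbT.
  by apply: integral_ge0 => x _; rewrite lee_fin powR_ge0.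
- rewrite in_itv/= leey andbT.
  by apply: integral_ge0 => x _; rewrite lee_fin powR_ge0.
apply: ge0_le_integral => //.
- by move=> x _; exact: poweR_ge0.
- exact: measurable_normf_poweR.
- apply: measurableT_comp (measurable_poweR p) _.
  apply: measurableT_comp => //; apply/measurable_EFinP.
  by apply: measurable_funD; exact: measurable_normf.
- move=> x _; apply: gt0_ler_poweR; rewrite ?(ltW p_gt0)// ?in_itv/= ?leey ?lee_fin ?normr_ge0//.
  rewrite /normf !ger0_norm ?addr_ge0 ?rnorm_ge0//.
  exact: ler_rnormD.
Qed.

Lemma bochner_normZ (a : R[i]) u : strongly_measurable u ->
  bochner_norm (a *: u) = ((complex.Re `|a|)%:E * bochner_norm u)%E.
Proof.
move=> su.
have a0 : 0 <= complex.Re `|a| by rewrite -ler0c RRe_real ?normr_real.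
rewrite /bochner_norm unlock /=.
rewrite (eq_integral (fun x =>
    ((complex.Re `|a|) `^ p)%:E * (`|(normf u x)%:E| `^ p))%E); last first.
  move=> x _.
  by rewrite /= /normf rnormZ normrM powRM// EFinM (ger0_norm a0).
rewrite ge0_integralZl//; last 3 first.
- exact: measurable_normf_poweR.
- by move=> x _; exact: poweR_ge0.
- by rewrite lee_fin powR_ge0.
rewrite poweRM ?lee_fin ?powR_ge0//; last first.
  by apply: integral_ge0 => x _; exact: poweR_ge0.
by rewrite poweR_EFin -powRrM divff ?gt_eqF// powRr1.
Qed.

Lemma bochner_norm_eq0 u : strongly_measurable u ->
  bochner_norm u = 0%E -> u = 0 %[ae mu].
Proof.
move=> su /Lnorm_eq0_eq0; have /measurable_EFinP mu_ := measurable_normf su.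
move=> /(_ mu_); rewrite lte_fin => /(_ p_gt0).
by apply: filterS => x /(_ I)[] /rnorm0_eq0.
Qed.

Lemma eq_bochner_norm u v : strongly_measurable u -> strongly_measurable v ->
  u = v %[ae mu] -> bochner_norm u = bochner_norm v.
Proof.
move=> su sv uv; rewrite /bochner_norm unlock; congr (_ `^ _)%E.
apply: ge0_ae_eq_integral => //.
- exact: measurable_normf_poweR.
- exact: measurable_normf_poweR.
- by move=> x _; exact: poweR_ge0.
- by move=> x _; exact: poweR_ge0.
by apply: filterS uv => x /(_ I) + _; rewrite /= /normf => ->.
Qed.

End bochner_norm.

Section bochner_fun.
Context d (T : measurableType d) (R : realType).
Variables (mu : {measure set T -> \bar R}) (H : normedModType R[i]).
Variable p : R.

(* The unused proof of 1 <= p lets the closure properties of this predicate be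
   found by instance inference. *)
Definition p_integrable & 1 <= p : {pred T -> H} :=
  mem [set u | strongly_measurable u /\ (bochner_norm mu p u < +oo)%E].

Variable p1 : 1 <= p.

Lemma p_integrable_submod_closed : submod_closed (p_integrable p1).
Proof.
split.
  rewrite inE; split; first exact: strongly_measurable0.
  by rewrite bochner_norm0.
move=> a u v; rewrite !inE => -[su Nu] [sv Nv].
split; first exact: strongly_measurableP.
have sau : strongly_measurable (a *: u).
  by rewrite -[_ *: _]addr0; apply: strongly_measurableP => //;
    exact: strongly_measurable0.
apply: (le_lt_trans (ler_bochner_normD mu p1 sau sv)).
rewrite lte_add_pinfty// bochner_normZ// lte_mul_pinfty//.
by rewrite lee_fin -ler0c RRe_real ?normr_real.
Qed.

HB.instance Definition _ := GRing.isSubmodClosed.Build R[i] (T -> H)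
  (p_integrable p1) p_integrable_submod_closed.

Record bochner_fun := BochnerFun {
  bochner_fun_val : T -> H;
  _ : bochner_fun_val \in p_integrable p1 }.

HB.instance Definition _ := [isSub for bochner_fun_val].
HB.instance Definition _ := [Choice of bochner_fun by <:].
HB.instance Definition _ := [SubChoice_isSubLmodule of bochner_fun by <:].

Lemma bochner_funP (u : bochner_fun) :
  strongly_measurable (val u) /\ (bochner_norm mu p (val u) < +oo)%E.
Proof. by have := valP u; rewrite inE. Qed.

Definition ae_null : {pred bochner_fun} :=
  mem [set u | val u = 0 %[ae mu]].

Lemma ae_null_submod_closed : submod_closed ae_null.
Proof.
split; first by rewrite inE; apply: nearW => x _.
move=> a u v; rewrite !inE /= => u0 v0.
apply: filterS2 u0 v0 => x /(_ I) ux /(_ I) vx _.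
by rewrite /GRing.add/= /GRing.scale/= ux vx scaler0 addr0.
Qed.

HB.instance Definition _ := GRing.isSubmodClosed.Build R[i] bochner_fun
  ae_null ae_null_submod_closed.

(* The Bochner space L_p(T, H): p-integrable functions modulo equality almost
   everywhere. *)
Definition bochner : Type := Quotient.quot ae_null.

HB.instance Definition _ := GRing.Zmodule.on bochner.
HB.instance Definition _ := EqQuotient.on bochner.


Local Open Scope quotient_scope.

Definition bochner_repr (u : bochner) : T -> H := val (repr u).

Lemma bochner_reprP (u : bochner) :
  strongly_measurable (bochner_repr u) /\
  (bochner_norm mu p (bochner_repr u) < +oo)%E.
Proof. exact: bochner_funP. Qed.

Lemma bochner_piD : {morph \pi_bochner : u v / u + v}.
Proof. exact: Quotient.pi_add. Qed.

Lemma bochner_pi0 : \pi_bochner 0 = 0.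
Proof. by apply: (addIr (\pi_bochner 0)); rewrite -bochner_piD !add0r. Qed.

Lemma bochner_piP (u v : bochner_fun) :
  \pi_bochner u = \pi_bochner v <-> val u = val v %[ae mu].
Proof.
split=> [/eqP|uv].
  rewrite -[_ == _]Quotient.idealrBE inE/=; apply: filterS => x /(_ I) + _.
  by move=> /eqP; rewrite subr_eq0 => /eqP.
apply/eqP; rewrite -[_ == _]Quotient.idealrBE inE/=.
by apply: filterS uv => x /(_ I) uvx _; apply/eqP; rewrite subr_eq0; apply/eqP.
Qed.

Lemma bochner_repr_pi (u : bochner_fun) :
  bochner_repr (\pi_bochner u) = val u %[ae mu].
Proof. by apply/bochner_piP; rewrite reprK. Qed.

Lemma bochner_reprD (u v : bochner) :
  bochner_repr (u + v) = bochner_repr u + bochner_repr v %[ae mu].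
Proof.
suff : \pi_bochner (repr (u + v)) = \pi_bochner (repr u + repr v).
  move=> /(proj1 (bochner_piP _ _)) uv.
  apply: filterS uv => x /(_ I) + _; exact.
by rewrite bochner_piD !reprK.
Qed.

Definition bochner_scale (a : R[i]) (u : bochner) : bochner :=
  \pi_bochner (a *: repr u).

Lemma bochner_scale_pi a u :
  bochner_scale a (\pi_bochner u) = \pi_bochner (a *: u).
Proof.
apply/bochner_piP; have := bochner_repr_pi u.
apply: filterS => x /(_ I) ux _; rewrite /bochner_repr in ux.
by rewrite -[LHS]/(a *: val (repr (\pi_bochner u)) x) ux.
Qed.

Lemma bochner_scaleA a b u :
  bochner_scale a (bochner_scale b u) = bochner_scale (a * b) u.
Proof.
by rewrite -[u]reprK (bochner_scale_pi b) (bochner_scale_pi a) scalerA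
  (bochner_scale_pi (a * b)).
Qed.

Lemma bochner_scale1 : left_id 1 bochner_scale.
Proof. by move=> u; rewrite /bochner_scale scale1r reprK. Qed.

Lemma bochner_scaleDr : right_distributive bochner_scale +%R.
Proof.
move=> a u v; rewrite -[u]reprK -[v]reprK -bochner_piD.
by rewrite (bochner_scale_pi a (_ + _)) !(bochner_scale_pi a (repr _)) scalerDr
  bochner_piD.
Qed.

Lemma bochner_scaleDl u : {morph bochner_scale^~ u : a b / a + b}.
Proof.
by move=> a b; rewrite /bochner_scale scalerDl bochner_piD.
Qed.

HB.instance Definition _ := GRing.Zmodule_isLmodule.Build R[i] bochner
  bochner_scaleA bochner_scale1 bochner_scaleDr bochner_scaleDl.

Lemma bochner_reprZ a (u : bochner) :
  bochner_repr (a *: u) = a *: bochner_repr u %[ae mu].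
Proof. exact: bochner_repr_pi. Qed.

Definition bochner_normr (u : bochner) : R[i] :=
  (fine (bochner_norm mu p (bochner_repr u)))%:C.

Let bochner_norm_fin (u : bochner) :
  bochner_norm mu p (bochner_repr u) \is a fin_num.
Proof.
by rewrite ge0_fin_numE ?Lnorm_ge0//; have [] := bochner_reprP u.
Qed.

Lemma ler_bochner_normrD u v :
  bochner_normr (u + v) <= bochner_normr u + bochner_normr v.
Proof.
have [su _] := bochner_reprP u; have [sv _] := bochner_reprP v.
have [suv _] := bochner_reprP (u + v).
have suv' : strongly_measurable (bochner_repr u + bochner_repr v).
  by rewrite -[bochner_repr u]scale1r; exact: strongly_measurableP.
rewrite /bochner_normr -rmorphD lecR -lee_fin EFinD !fineK//.
rewrite (eq_bochner_norm p suv suv' (bochner_reprD u v)).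
exact: ler_bochner_normD.
Qed.

Lemma bochner_normrZ a u : bochner_normr (a *: u) = `|a| * bochner_normr u.
Proof.
have [su _] := bochner_reprP u; have [sau _] := bochner_reprP (a *: u).
have sau' : strongly_measurable (a *: bochner_repr u).
  by rewrite -[_ *: _]addr0; apply: strongly_measurableP => //;
    exact: strongly_measurable0.
rewrite /bochner_normr (eq_bochner_norm p sau sau' (bochner_reprZ a u)).
by rewrite bochner_normZ// fineM// rmorphM; congr (_ * _).
Qed.

Lemma bochner_normr0_eq0 u : bochner_normr u = 0 -> u = 0.
Proof.
have [su _] := bochner_reprP u.
move=> /(@complexI R) u0.
have /(bochner_norm_eq0 p1 su) {}u0 : bochner_norm mu p (bochner_repr u) = 0%E.
  by rewrite -[LHS]fineK// u0.
rewrite -[u]reprK -bochner_pi0; exact/bochner_piP.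
Qed.

HB.instance Definition _ := Lmodule_isNormed.Build R[i] bochner
  ler_bochner_normrD bochner_normrZ bochner_normr0_eq0.

End bochner_fun.

Coercion bochner_repr : bochner >-> Funclass.

Lemma le1_2 (R : realType) : 1 <= 2 :> R. Proof. by rewrite ler1n. Qed.

Notation L2 mu H := (bochner mu H (le1_2 _)).

Section L2.
Context d (T : measurableType d) (R : realType).
Variables (mu : {measure set T -> \bar R}) (H : hilbertType R).

(* The integral of the complex function x |-> inner (f x) (g x), taken on its
   real and imaginary parts. *)
Definition L2_inner (f g : L2 mu H) : R[i] :=
  (\int[mu]_x complex.Re (inner (f x) (g x))) +i*
  (\int[mu]_x complex.Im (inner (f x) (g x))).

Definition L2_cap_Lp (p : R) (p1 : 1 <= p) : set (L2 mu H) :=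
  [set u | (u : T -> H) \in p_integrable mu p1].

Definition L2_Lp_ball (p : R) (p1 : 1 <= p) : set (L2 mu H) :=
  [set u | L2_cap_Lp p1 u /\ (bochner_norm mu p u <= 1)%E].

End L2.

Section sgn.
Context (T : Type) (R : realType) (H : normedModType R[i]).

Definition sgnf (u : T -> H) : T -> H :=
  fun x => if u x == 0 then 0 else `|u x|^-1 *: u x.

Definition normf_pow_sgnf (p : R) (u : T -> H) : T -> H :=
  fun x => (rnorm (u x) `^ (p - 1))%:C *: sgnf u x.

End sgn.

Section projection.
Context (R : realType) (X : normedModType R[i]).

Definition closest (C : set X) (f : X) : set X :=
  [set g | C g /\ forall h, C h -> `|f - g| <= `|f - h|].

Definition orthogonal_projection (C : set X) (P : X -> X) :=
  forall f, closest C f = [set P f].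

End projection.

Section semigroup.
Context (R : realType) (X : normedModType R[i]).

(* The values S t with t <= 0 are irrelevant. *)
Definition C0_semigroup (S : R -> X -> X) :=
  [/\ forall t, 0 < t -> linear (S t),
      forall t, 0 < t -> continuous (S t),
      forall s t, 0 < s -> 0 < t -> S (s + t) = S s \o S t &
      forall u, S t u @[t --> 0^'+] --> u].

(* Possibly unbounded operators are represented by their graphs. *)
Definition generator (S : R -> X -> X) : set (X * X) :=
  [set uf | t^-1%:C *: (S t uf.1 - uf.1) @[t --> 0^'+] --> uf.2].

Definition generates (B : set (X * X)) (S : R -> X -> X) :=
  C0_semigroup S /\ generator S = B.

Definition opp_operator (A : set (X * X)) : set (X * X) :=
  [set (uf.1, - uf.2) | uf in A].

End semigroup.

Notation "{ 'sesquilinear' V }" :=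
  {bilinear V -> V -> _ | *%R & (@conjC _ \; *%R)}
  (format "{ 'sesquilinear'  V }") : type_scope.

Section forms.
Context d (T : measurableType d) (R : realType).
Variables (mu : {measure set T -> \bar R}) (H V : hilbertType R).
Variable j : V -> L2 mu H.

Definition dense_embedding :=
  [/\ injective j, continuous j & dense (range j)].

Variable a : V -> V -> R[i].

Definition continuous_form :=
  exists2 M : R, 0 < M & forall u v, `|a u v| <= M%:C * `|u| * `|v|.

Definition elliptic_form :=
  exists kappa omega : R, 0 < kappa /\
    forall u, kappa * rnorm u ^+ 2 <=
              complex.Re (a u u) + omega * rnorm (j u) ^+ 2.

Definition form_operator : set (L2 mu H * L2 mu H) :=
  [set uf | exists2 u : V, j u = uf.1 &
            forall v : V, a u v = L2_inner uf.2 (j v)].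

End forms.

(* Main.v *)
(* Write P for the projection onto C, the ball of L_p in L_2. For a closed convex
   set C, S leaves C invariant iff P V is contained in V and
   Re a(P u, u - P u) >= 0 on V (Ouhabaz). If C is invariant under S, then it is
   invariant under lam (lam + A)^-1 for large lam, so that
   w = lam (lam + A)^-1 P u satisfies Re a(w, w - u) <= 0; hence w stays bounded
   in V as lam tends to infinity, and P u is the weak limit of w. Conversely, the
   form condition makes C invariant under lam (lam + A)^-1, and the squared
   distance of S_t x to C satisfies a Gronwall inequality when x is in the domain
   of A.
     For the unit ball of L_p, u = P f iff f - u = c |u|^(p-1) sgn u with c >= 0
   (and c = 0 unless |u|_p = 1): the functional Re (f - u, .) attains its maximum
   over the ball at u, so the dual norm of f - u is Re (f - u, u), and equality
   holds in Young's inequality almost everywhere. *)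
Require Import Defs.
From mathcomp Require Import all_boot all_order all_algebra complex.
From mathcomp Require Import generic_quotient sesquilinear ring lra.
From mathcomp Require Import all_classical all_reals all_analysis.
From mathcomp Require Import measurable_realfun.

Set Implicit Arguments.
Unset Strict Implicit.
Unset Printing Implicit Defensive.

Import Order.TTheory GRing.Theory Num.Theory Num.Def.
Import numFieldNormedType.Exports.
Local Open Scope classical_set_scope.
Local Open Scope complex_scope.
Local Open Scope ring_scope.

(** * Real inner products *)

(** Weak limits are replaced by a common point of decreasing bounded closed convex sets in [V]
    ([nested_convex]), the sets being sublevel sets of quadratic functionals or balls. The same
    principle gives the minimizers behind Lax-Milgram and the bad point in Banach-Steinhaus; all of
    this takes place in [V], which is complete by its structure. Invariance of [C] passes from [S]
    to the resolvent by pairing [S h x - x] with [x - P x] at [x = lam (lam + A)^-1 f], in place of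
    a Laplace integral. The Gronwall argument needs semicontinuity from the left, while a generator
    gives right derivatives only. It comes from the bound [exp (omega t)] on [S t], itself proved by
    Gronwall for small times and on the domain, where convergence in [V] supplies the left
    semicontinuity. The form conditions match by homogeneity: for [v = P u] the vector [u - v] is
    [c] times [|v|^(p-1) sgn v]; conversely a nonzero [u] is scaled to norm 1 in [L_p], where
    [u = P (u + |u|^(p-1) sgn u)]. *)

Section real_norm.
Context (R : realType) (X : normedModType R[i]).
Implicit Types (x y : X) (t : R).

Lemma rnormZr t x : rnorm (t%:C *: x) = `|t| * rnorm x.
Proof. by rewrite rnormZ normc_def/= expr0n/= addr0 sqrtr_sqr. Qed.

Lemma rnormN x : rnorm (- x) = rnorm x.
Proof. by rewrite /rnorm normrN. Qed.

Lemma rnormB x y : rnorm (x - y) = rnorm (y - x).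
Proof. by rewrite -rnormN opprB. Qed.

Lemma ler_rnorm_distD x y z : rnorm (x - z) <= rnorm (x - y) + rnorm (y - z).
Proof. by have := ler_rnormD (x - y) (y - z); rewrite addrA subrK. Qed.

Lemma rnorm_sub_norm x y : rnorm x - rnorm y <= rnorm (x - y).
Proof. by have := ler_rnormD (x - y) y; rewrite subrK lerBlDr. Qed.

End real_norm.

Section real_bilinear.
Context (R : realType) (X : normedModType R[i]).
Implicit Types (f : X -> R) (b : X -> X -> R).

(* The argument only uses the underlying real spaces: linearity is over real
   scalars, and inner products and forms are replaced by their real parts. *)
Definition rlinear f := forall (t : R) x y, f (t%:C *: x + y) = t * f x + f y.

Definition rbilinear b := (forall y, rlinear (b^~ y)) /\ (forall x, rlinear (b x)).

Definition real_inner b :=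
  [/\ rbilinear b, forall x y, b x y = b y x & forall x, b x x = rnorm x ^+ 2].

Lemma rlinear0 f : rlinear f -> f 0 = 0.
Proof. by move=> lf; have := lf 1 0 0; rewrite scaler0 addr0 mul1r; lra. Qed.

Lemma rlinearD f x y : rlinear f -> f (x + y) = f x + f y.
Proof. by move=> lf; have := lf 1 x y; rewrite scale1r mul1r. Qed.

Lemma rlinearZ f t x : rlinear f -> f (t%:C *: x) = t * f x.
Proof. by move=> lf; have := lf t x 0; rewrite !addr0 (rlinear0 lf) addr0. Qed.

Lemma rlinearN f x : rlinear f -> f (- x) = - f x.
Proof.
by move=> lf; have := rlinearZ (-1) x lf; rewrite rmorphN rmorph1 scaleN1r mulN1r.
Qed.

Lemma rlinearB f x y : rlinear f -> f (x - y) = f x - f y.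
Proof. by move=> lf; rewrite rlinearD// rlinearN. Qed.

Variable b : X -> X -> R.

Section rbilinear_theory.
Hypothesis bb : rbilinear b.

Lemma rbDl x y z : b (x + y) z = b x z + b y z.
Proof. exact: (rlinearD _ _ (bb.1 z)). Qed.
Lemma rbDr x y z : b x (y + z) = b x y + b x z.
Proof. exact: (rlinearD _ _ (bb.2 x)). Qed.
Lemma rbBl x y z : b (x - y) z = b x z - b y z.
Proof. exact: (rlinearB _ _ (bb.1 z)). Qed.
Lemma rbBr x y z : b x (y - z) = b x y - b x z.
Proof. exact: (rlinearB _ _ (bb.2 x)). Qed.
Lemma rbNl x y : b (- x) y = - b x y.
Proof. exact: (rlinearN _ (bb.1 y)). Qed.
Lemma rbNr x y : b x (- y) = - b x y.
Proof. exact: (rlinearN _ (bb.2 x)). Qed.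
Lemma rbZl t x y : b (t%:C *: x) y = t * b x y.
Proof. exact: (rlinearZ _ _ (bb.1 y)). Qed.
Lemma rbZr t x y : b x (t%:C *: y) = t * b x y.
Proof. exact: (rlinearZ _ _ (bb.2 x)). Qed.

Definition rbE := (rbDl, rbDr, rbBl, rbBr, rbNl, rbNr, rbZl, rbZr).

End rbilinear_theory.

Hypothesis bi : real_inner b.

Lemma real_inner_bil : rbilinear b. Proof. by case: bi. Qed.
Lemma real_innerC x y : b x y = b y x. Proof. by case: bi. Qed.
Lemma real_innerxx x : b x x = rnorm x ^+ 2. Proof. by case: bi. Qed.

Let bb := real_inner_bil.

Lemma rnormD_sqr x y : rnorm (x + y) ^+ 2 = rnorm x ^+ 2 + 2 * b x y + rnorm y ^+ 2.
Proof.
by rewrite -!real_innerxx !(rbE bb) (real_innerC y x); ring.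
Qed.

Lemma rnormB_sqr x y : rnorm (x - y) ^+ 2 = rnorm x ^+ 2 - 2 * b x y + rnorm y ^+ 2.
Proof. by rewrite rnormD_sqr rnormN (rbE bb) mulrN. Qed.

Lemma real_inner_le x y : b x y <= rnorm x * rnorm y.
Proof.
have := rnormD_sqr x y.
have : rnorm (x + y) ^+ 2 <= (rnorm x + rnorm y) ^+ 2.
  by rewrite ler_pXn2r// ?nnegrE ?addr_ge0 ?rnorm_ge0// ler_rnormD.
rewrite sqrrD -mulr_natl; lra.
Qed.

Lemma real_inner_norm_le x y : `|b x y| <= rnorm x * rnorm y.
Proof.
rewrite ler_norml real_inner_le andbT lerNl -(rbNl bb) -(rnormN x).
exact: real_inner_le.
Qed.

End real_bilinear.

(** * Nested convex sets as a substitute for weak compactness *)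

Section nested_convex.
Context (R : realType) (V : completeNormedModType R[i]).
Variable b : V -> V -> R.
Hypothesis bi : real_inner b.

Lemma cauchy_rnorm_cvg (s : nat -> V) :
  (forall e : R, 0 < e -> exists N, forall n, (N <= n)%N -> rnorm (s N - s n) < e) ->
  exists v, forall e : R, 0 < e -> exists N, forall n, (N <= n)%N -> rnorm (v - s n) < e.
Proof.
move=> cs; have : cvg (s @ \oo).
  apply/cauchy_cvgP/cauchy_exP => e e0.
  have re0 : 0 < complex.Re e by move: e0; rewrite ltcE/= => /andP[].
  have [N HN] := cs _ re0.
  exists (s N); exists N => // n /= Nn; rewrite -ball_normE/=.
  rewrite -rnormE -[e]RRe_real ?ltcR ?HN// realE ltW//.
move=> /cvgrPdist_lt sv; exists (lim (s @ \oo)) => e e0.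
have e0' : 0 < e%:C :> R[i] by rewrite ltcR.
have [N _ HN] := sv _ e0'.
by exists N => n Nn; rewrite -ltcR rnormE; exact: HN.
Qed.

(** Points [s n] of nearly minimal norm in [K n] form a Cauchy sequence: for [n <= m] the midpoint
    of [s n] and [s m] lies in [K n], so the parallelogram law bounds their distance by the growth
    of the minimal norms, which are monotone and bounded by [M]. *)
Lemma nested_convex (K : nat -> set V) (M : R) :
  (forall n, K n !=set0) -> (forall n, K n.+1 `<=` K n) ->
  (forall n x y, K n x -> K n y -> K n (2^-1%:C *: (x + y))) ->
  (forall n v, (forall e : R, 0 < e -> exists2 w, K n w & rnorm (v - w) < e) -> K n v) ->
  (forall v, K 0%N v -> rnorm v <= M) ->
  exists v, forall n, K n v.
Proof.
move=> K0 Kdec Kmid Kcl KM.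
have Kle m n : (m <= n)%N -> K n `<=` K m.
  move=> /subnK <-; elim: (n - m)%N => [//|k IH]; rewrite addSn.
  exact: subset_trans (Kdec _) IH.
pose N2 n := [set rnorm v ^+ 2 | v in K n].
pose dist2 n := inf (N2 n).
have N20 n : N2 n !=set0 by have [v Kv] := K0 n; exists (rnorm v ^+ 2); exists v.
have N2lb n : has_lbound (N2 n) by exists 0 => _ [v _ <-]; exact: sqr_ge0.
have dist2_le n v : K n v -> dist2 n <= rnorm v ^+ 2.
  by move=> Kv; apply: ge_inf => //; exists v.
have dist2_nd m n : (m <= n)%N -> dist2 m <= dist2 n.
  move=> mn; apply: lb_le_inf => // _ [v Kv <-]; apply: dist2_le.
  exact: Kle Kv.
have dist2_M n : dist2 n <= M ^+ 2.
  have [v Kv] := K0 n; apply: le_trans (dist2_le _ _ Kv) _.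
  by rewrite lerXn2r ?nnegrE ?rnorm_ge0 ?(le_trans (rnorm_ge0 v))// KM//; exact: Kle Kv.
have /choice[s sP] n : exists v, K n v /\ rnorm v ^+ 2 < dist2 n + n.+1%:R^-1.
  have n0 : 0 < n.+1%:R^-1 :> R by rewrite invr_gt0.
  have [_ [v Kv <-] vd] := inf_adherent n0 (conj (N20 n) (N2lb n)).
  by exists v.
have sd n m : (n <= m)%N ->
    rnorm (s n - s m) ^+ 2 <= 2 * (dist2 m - dist2 n) + 4 * n.+1%:R^-1.
  move=> nm; have [Kn dn] := sP n; have [Km dm] := sP m.
  have := dist2_le _ _ (Kmid _ _ _ Kn (Kle _ _ nm _ Km)).
  rewrite rnormZr exprMn (rnormD_sqr bi) (rnormB_sqr bi) ger0_norm ?invr_ge0//.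
  have : m.+1%:R^-1 <= n.+1%:R^-1 :> R by rewrite lef_pV2 ?posrE// ler_nat.
  move: dn dm; set a := rnorm _ ^+ 2; set c := rnorm _ ^+ 2; set ab := b _ _.
  set x := n.+1%:R^-1; set y := m.+1%:R^-1.
  nra.
have [v vP] : exists v, forall e : R, 0 < e ->
    exists N, forall n, (N <= n)%N -> rnorm (v - s n) < e.
  apply: cauchy_rnorm_cvg => e e0.
  have hs : has_sup (range dist2).
    by split; [exists (dist2 0%N), 0%N|exists (M ^+ 2) => _ [n _ <-]].
  (* In [sd] the growth of [dist2] counts twice and the reciprocal four times; with both below
     [e ^+ 2 / 8] the sum stays below [e ^+ 2]. *)
  have e8 : 0 < e ^+ 2 / 8 by rewrite divr_gt0 ?exprn_gt0.
  have [_ [N1 _ <-] HN1] := sup_adherent e8 hs.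
  have [N2' HN2] : exists n : nat, n.+1%:R^-1 < e ^+ 2 / 8.
    by exists (truncn (e ^+ 2 / 8)^-1); rewrite invf_plt ?posrE// truncnS_gt.
  exists (maxn N1 N2') => n Nn.
  rewrite -(ltr_pXn2r (n := 2))// ?nnegrE ?rnorm_ge0 ?(ltW e0)//.
  apply: le_lt_trans (sd _ _ Nn) _.
  have : dist2 n <= sup (range dist2) by apply: ub_le_sup; [case: hs|exists n].
  have := dist2_nd _ _ (leq_maxl N1 N2').
  have : (maxn N1 N2').+1%:R^-1 <= N2'.+1%:R^-1 :> R.
    by rewrite lef_pV2 ?posrE// ler_nat ltnS leq_maxr.
  set x := (maxn _ _).+1%:R^-1; set y := _.+1%:R^-1 in HN2 *; lra.
exists v => n; apply: Kcl => e e0.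
have [N HN] := vP e e0.
exists (s (maxn N n)); last by rewrite HN// leq_maxl.
by have [Ks _] := sP (maxn N n); apply: Kle Ks; rewrite leq_maxr.
Qed.

End nested_convex.

(** * The Lax-Milgram theorem *)

(** At [t = - p / (|q| + 1)] the polynomial is a negative multiple of [p ^+ 2]; the [+ 1] covers
    [q = 0]. It serves as the first-variation argument at a minimizer. *)
Lemma quadratic_ge0_eq0 (R : realFieldType) (p q : R) :
  (forall t : R, 0 <= 2 * t * p + t ^+ 2 * q) -> p = 0.
Proof.
move=> h; have q1 : 0 < `|q| + 1 by rewrite ltr_wpDl.
apply/eqP; rewrite -sqrf_eq0 eq_le sqr_ge0 andbT.
have := h (- p / (`|q| + 1)).
rewrite -(pmulr_lge0 _ (exprn_gt0 2 q1)).
have -> : (2 * (- p / (`|q| + 1)) * p + (- p / (`|q| + 1)) ^+ 2 * q) *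
    (`|q| + 1) ^+ 2 = p ^+ 2 * (q - 2 * `|q| - 2).
  by field; rewrite gt_eqF.
have := ler_norm q; have := sqr_ge0 p; have := normr_ge0 q; nra.
Qed.

Section quadratic_functionals.
Context (R : realType) (V : normedModType R[i]).

Definition rbounded (l : V -> R) (C : R) := forall x, `|l x| <= C * rnorm x.

Definition rbibounded (B : V -> V -> R) (C : R) :=
  forall x y, `|B x y| <= C * rnorm x * rnorm y.

Lemma rbounded_norm l C : rbounded l C -> rbounded l `|C|.
Proof.
by move=> lC x; apply: le_trans (lC x) _; rewrite ler_wpM2r ?rnorm_ge0// ler_norm.
Qed.

Lemma rbibounded_norm B C : rbibounded B C -> rbibounded B `|C|.
Proof.
move=> BC x y; apply: le_trans (BC x y) _.
by rewrite -!mulrA ler_wpM2r ?ler_norm// mulr_ge0 ?rnorm_ge0.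
Qed.

(** The sublevel sets of these functionals are midpoint-convex and norm-closed, as [nested_convex]
    requires. One constant [C] serves [B] and [l] alike, and [B] may be nonsymmetric. *)
Definition convex_quadratic (F : V -> R) := exists B l c C,
  [/\ rbilinear B /\ rlinear l, forall v, 0 <= B v v,
      rbibounded B C, rbounded l C & forall v, F v = B v v + l v + c].

Lemma convex_quadratic_closed F c v : convex_quadratic F ->
  (forall e : R, 0 < e -> exists2 w, F w <= c & rnorm (v - w) < e) -> F v <= c.
Proof.
move=> [B [l [d [C [[rB rl] _ Bb lb FE]]]]] vc; rewrite leNgt; apply/negP => cF.
(* [L] is a Lipschitz constant of [F] at [v] on the ball of radius 1, where
   [rnorm w <= rnorm v + 1]; the final [+ 1] makes it positive. *)
pose L := `|C| * (2 * rnorm v + 2) + 1.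
have L0 : 0 < L by rewrite ltr_wpDl// mulr_ge0// addr_ge0// mulr_ge0// rnorm_ge0.
have e0 : 0 < Order.min 1 ((F v - c) / L).
  by rewrite lt_min ltr01 divr_gt0// subr_gt0.
have [w Fw] := vc _ e0; rewrite lt_min ltr_pdivlMr// => /andP[vw1 vwL].
have wv : rnorm w <= rnorm v + 1.
  by have := rnorm_sub_norm w v; rewrite rnormB; lra.
have B1 := Bb v (v - w); have B2 := Bb (v - w) w; have B3 := lb (v - w).
have E : F v - F w = B v (v - w) + B (v - w) w + l (v - w).
  by rewrite !FE !(rbE rB) (rlinearB _ _ rl); ring.
have CC := ler_norm C.
have : F v - F w <= `|C| * rnorm (v - w) * (2 * rnorm v + 2).
  rewrite E; move: B1 B2 B3; rewrite !ler_norml => /andP[_ B1] /andP[_ B2] /andP[_ B3].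
  have h x : 0 <= x -> C * x <= `|C| * x by move=> x0; rewrite ler_wpM2r.
  have n0 := rnorm_ge0 (v - w); have v0 := rnorm_ge0 v; have w0 := rnorm_ge0 w.
  have H1 := h _ (mulr_ge0 v0 n0); have H2 := h _ (mulr_ge0 n0 w0); have H3 := h _ n0.
  have H4 : `|C| * rnorm (v - w) * rnorm w <= `|C| * rnorm (v - w) * (rnorm v + 1).
    by rewrite ler_wpM2l// mulr_ge0.
  lra.
rewrite /L in vwL.
have := rnorm_ge0 (v - w); nra.
Qed.

Lemma convex_quadratic_mid F c v w : convex_quadratic F ->
  F v <= c -> F w <= c -> F (2^-1%:C *: (v + w)) <= c.
Proof.
move=> [B [l [d [C [[rB rl] B0 _ _ FE]]]]].
rewrite !FE !(rbE rB) (rlinearZ _ _ rl) (rlinearD _ _ rl).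
have := B0 (v - w); rewrite !(rbE rB); lra.
Qed.

End quadratic_functionals.

Section lax_milgram.
Context (R : realType) (V : completeNormedModType R[i]).
Variable b : V -> V -> R.
Hypothesis bi : real_inner b.

Lemma symmetric_lax_milgram (B : V -> V -> R) (l : V -> R) (k C : R) :
  rbilinear B -> (forall x y, B x y = B y x) -> rlinear l ->
  rbibounded B C -> rbounded l C -> 0 < k ->
  (forall v, k * rnorm v ^+ 2 <= B v v) ->
  exists u, forall v, B u v = l v.
Proof.
move=> rB Bs rl BC lC k0 Bk.
have {}BC := rbibounded_norm BC; have {}lC := rbounded_norm lC.
move: `|C| (normr_ge0 C) BC lC => {}C C0 BC lC.
have B0 v : 0 <= B v v by apply: le_trans (Bk v); rewrite mulr_ge0 ?sqr_ge0 ?ltW.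
pose F v := B v v + - 2 * l v.
have cF : convex_quadratic F.
  exists B, (fun v => - 2 * l v), 0, (2 * C); split => //.
  - by split=> // t x y; rewrite rl; ring.
  - move=> x y; apply: le_trans (BC x y) _.
    by rewrite -!mulrA ler_peMl ?mulr_ge0 ?rnorm_ge0 ?ler1n.
  - by move=> x; rewrite normrM normrN normr_nat -mulrA ler_pM2l.
  - by move=> v; rewrite addr0.
have Flb v : k * rnorm v ^+ 2 - 2 * C * rnorm v <= F v.
  by have := lC v; rewrite ler_norml => /andP[_]; have := Bk v; rewrite /F; lra.
have F_lb : has_lbound (range F).
  exists (- (C ^+ 2 / k)) => _ [v _ <-]; apply: le_trans (Flb v).
  rewrite -subr_ge0; have -> : k * rnorm v ^+ 2 - 2 * C * rnorm v - - (C ^+ 2 / k)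
    = k * (rnorm v - C / k) ^+ 2 by field; rewrite gt_eqF.
  by rewrite mulr_ge0 ?sqr_ge0 ?ltW.
pose I := inf (range F).
have F_I v : I <= F v by apply: ge_inf => //; exists v.
have [|||||u uP] := @nested_convex _ V b bi
    (fun n => [set v | F v <= I + n.+1%:R^-1]) (1 + (2 * C + (`|I| + 1)) / k).
- move=> n; have n0 : 0 < n.+1%:R^-1 :> R by rewrite invr_gt0.
  have hi : has_inf (range F) by split=> //; exists (F 0), 0.
  by have [_ [v _ <-] Fv] := inf_adherent n0 hi; exists v => /=; exact: ltW.
- move=> n v /= /le_trans; apply; rewrite lerD2l lef_pV2 ?posrE//.
  by rewrite ler_nat.
- by move=> n v w /=; exact: convex_quadratic_mid.
- move=> n v /=; exact: convex_quadratic_closed.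
(* The radius covers two cases: [rnorm v <= 1], or [k * rnorm v ^+ 2 - 2 * C * rnorm v <= (|I| + 1)
   * rnorm v], which is divided by [rnorm v]. *)
- move=> v /=; rewrite invr1 => FI.
  have [v1|v1] := leP (rnorm v) 1.
    rewrite (le_trans v1)// lerDl divr_ge0 ?(ltW k0)//.
    by rewrite !addr_ge0// mulr_ge0.
  rewrite -lerBlDl ler_pdivlMr//.
  have := Flb v; have := ler_norm I; have := normr_ge0 I => h0 h1 h2.
  have h3 : (k * rnorm v - 2 * C) * rnorm v <= (`|I| + 1) * rnorm v.
    apply: (@le_trans _ _ (`|I| + 1)); last by rewrite ler_peMr ?addr_ge0// ltW.
    have -> : (k * rnorm v - 2 * C) * rnorm v = k * rnorm v ^+ 2 - 2 * C * rnorm v by ring.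
    lra.
  rewrite ler_pM2r in h3; last exact: lt_trans v1.
  lra.
exists u => v; apply/eqP; rewrite -subr_eq0; apply/eqP.
(* [u] lies in all sublevel sets, hence minimizes [F]; the increment of [F] from [u] to [u + t v] is
   [2 t (B u v - l v) + t^2 B v v]. *)
apply: (@quadratic_ge0_eq0 _ _ (B v v)) => t.
have Fu : F u <= F (u + t%:C *: v).
  apply: (@le_trans _ _ I) => //.
  rewrite leNgt; apply/negP => IF.
  have d0 : 0 < F u - I by rewrite subr_gt0.
  have := uP (truncn (F u - I)^-1); rewrite /= -lerBlDl; apply/negP; rewrite -ltNge.
  by rewrite invf_plt ?posrE// truncnS_gt.
rewrite -subr_ge0 in Fu; apply: le_trans Fu _.
rewrite /F !(rbE rB) (rlinearD _ _ rl) (rlinearZ _ _ rl) (Bs v u).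
by rewrite le_eqVlt; apply/orP; left; apply/eqP; ring.
Qed.

(* The Riesz theorem turns [B] and [l] into an operator [A] and a vector [g];
   the normal equation of minimizing [|A u - g|] then gives [A u = g]. *)
Lemma lax_milgram (B : V -> V -> R) (l : V -> R) (k C : R) :
  rbilinear B -> rlinear l -> rbibounded B C -> rbounded l C -> 0 < k ->
  (forall v, k * rnorm v ^+ 2 <= B v v) ->
  exists u, forall v, B u v = l v.
Proof.
move=> rB rl BC lC k0 Bk.
have {}BC := rbibounded_norm BC; have {}lC := rbounded_norm lC.
move: `|C| (normr_ge0 C) BC lC => {}C C0 BC lC.
have rb := real_inner_bil bi.
have riesz (g : V -> R) D : rlinear g -> rbounded g D -> exists u, forall v, b u v = g v.
  move=> rg gD; apply: (@symmetric_lax_milgram _ _ 1 (1 + `|D|)) => //.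
  - exact: real_innerC.
  - move=> x y; apply: le_trans (real_inner_norm_le bi x y) _.
    by rewrite -mulrA ler_peMl ?mulr_ge0 ?rnorm_ge0// lerDl.
  - move=> x; apply: le_trans (gD x) _; rewrite ler_wpM2r ?rnorm_ge0//.
    by rewrite (le_trans (ler_norm D))// lerDr.
  - by move=> v; rewrite mul1r (real_innerxx bi).
have Bbd u : rbounded (B u) (C * rnorm u) by move=> v; exact: BC.
have /choice[A AP] u : exists w, forall v, b w v = B u v.
  by apply: riesz (Bbd u); exact: rB.2.
have [g gP] := riesz _ _ rl lC.
have b_eq x y : (forall v, b x v = b y v) -> x = y.
  move=> xy; apply/eqP; rewrite -subr_eq0; apply/eqP/rnorm0_eq0/eqP.
  by rewrite -sqrf_eq0 -(real_innerxx bi) (rbBl rb) xy subrr.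
have Alin t u v : A (t%:C *: u + v) = t%:C *: A u + A v.
  by apply: b_eq => w; rewrite AP (rB.1) !(rbE rb) !AP.
have bA_lin u : rlinear (fun v => b u (A v)) by move=> t x y; rewrite Alin (rb.2).
have bA_lin' u : rlinear (fun v => b (A v) u) by move=> t x y; rewrite Alin (rb.1).
have A_le u : rnorm (A u) <= C * rnorm u.
  have [->|A0] := eqVneq (rnorm (A u)) 0; first by rewrite mulr_ge0 ?rnorm_ge0.
  have Au0 : 0 < rnorm (A u) by rewrite lt_neqAle eq_sym A0 rnorm_ge0.
  rewrite -(ler_pM2r Au0) -expr2 -(real_innerxx bi) AP.
  exact: le_trans (ler_norm _) (BC _ _).
have A_ge u : k * rnorm u <= rnorm (A u).
  have [->|u0] := eqVneq (rnorm u) 0; first by rewrite mulr0 rnorm_ge0.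
  have {}u0 : 0 < rnorm u by rewrite lt_neqAle eq_sym u0 rnorm_ge0.
  rewrite -(ler_pM2r u0) -mulrA -expr2; apply: le_trans (Bk u) _.
  by rewrite -AP; exact: real_inner_le.
have [u uP] : exists u, forall v, b (A u) (A v) = b g (A v).
  apply: (@symmetric_lax_milgram _ _ (k ^+ 2) (C ^+ 2 + rnorm g * C)).
  - by split => [v|v]; [exact: bA_lin'|exact: bA_lin].
  - by move=> x y; exact: real_innerC.
  - exact: bA_lin.
  - move=> x y; apply: le_trans (real_inner_norm_le bi _ _) _.
    apply: (@le_trans _ _ (C * rnorm x * (C * rnorm y))).
      by apply: ler_pM; rewrite ?rnorm_ge0.
    have := mulr_ge0 (rnorm_ge0 x) (rnorm_ge0 y).
    have := mulr_ge0 (rnorm_ge0 g) C0; nra.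
  - move=> x; apply: le_trans (real_inner_norm_le bi _ _) _.
    apply: (@le_trans _ _ (rnorm g * (C * rnorm x))).
      by rewrite ler_wpM2l ?rnorm_ge0.
    by rewrite mulrA ler_wpM2r ?rnorm_ge0// lerDr sqr_ge0.
  - by rewrite exprn_gt0.
  - move=> v; rewrite (real_innerxx bi) -exprMn.
    by rewrite lerXn2r ?nnegrE ?mulr_ge0 ?rnorm_ge0// ltW.
exists u => v; rewrite -AP -gP.
suff -> : A u = g by [].
(* The normal equation makes [A u - g] orthogonal to the range of [A], in particular to
   [A (A u - g)]; coercivity of [B] then forces [A u = g]. *)
have e0 : B (A u - g) (A u - g) = 0.
  by rewrite -AP real_innerC// (rbBl rb) uP subrr.
have := Bk (A u - g); rewrite e0 pmulr_rle0// => eu.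
apply/eqP; rewrite -subr_eq0; apply/eqP/rnorm0_eq0/eqP.
by rewrite -sqrf_eq0 eq_le eu sqr_ge0.
Qed.

End lax_milgram.

(** * Uniform boundedness and Dini derivatives *)

Section uniform_boundedness.
Context (R : realType) (V : completeNormedModType R[i]).
Variable b : V -> V -> R.
Hypothesis bi : real_inner b.

(* Banach-Steinhaus for a family of seminorms indexed by a parameter that tends
   to [0] from the right, by nested balls. *)
Lemma uniform_boundedness (p : R -> V -> R) :
  (forall t, 0 < t -> exists C, forall v, p t v <= C * rnorm v) ->
  (forall t v w, 0 < t -> p t (v + w) <= p t v + p t w) ->
  (forall t s v, 0 < t -> p t (s%:C *: v) = `|s| * p t v) ->
  (forall v, exists M d, 0 < d /\ forall t, 0 < t -> t < d -> p t v <= M) ->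
  exists M d, [/\ 0 <= M, 0 < d & forall t v, 0 < t -> t < d -> p t v <= M * rnorm v].
Proof.
move=> pb pD pZ pw; apply: contrapT => nub.
(* Otherwise [p t <= N] on a whole ball for all [t < d], and translating the ball to the origin
   bounds [p t] by [2 N / r] times the norm. *)
have large d x r N : 0 < d -> 0 < r ->
    exists t y, [/\ 0 < t, t < d, rnorm (y - x) <= r & N < p t y].
  move=> d0 r0; apply: contrapT => h; apply: nub.
  exists (`|N + N| / r), d; split => //.
    by rewrite divr_ge0// ltW.
  move=> t v t0 td.
  have pN y : rnorm (y - x) <= r -> p t y <= N.
    by move=> yx; rewrite leNgt; apply/negP => Np; apply: h; exists t, y.
  have [->|v0] := eqVneq v 0.
    by have := pZ t 0 0 t0; rewrite scaler0 normr0 mul0r => ->; rewrite rnorm0 mulr0.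
  have {}v0 : 0 < rnorm v.
    rewrite lt_neqAle rnorm_ge0 andbT eq_sym; apply: contra v0 => /eqP.
    by move=> /rnorm0_eq0 ->.
  have : p t ((r / rnorm v)%:C *: v) <= N + N.
    rewrite -[_ *: v](addrK x); apply: le_trans (pD _ _ _ t0) _; apply: lerD.
      apply: pN; rewrite addrK rnormZr ger0_norm ?divr_ge0 ?(ltW r0) ?(ltW v0)//.
      by rewrite divfK ?gt_eqF.
    have -> : - x = (-1)%:C *: x by rewrite rmorphN rmorph1 scaleN1r.
    rewrite pZ// normrN1 mul1r; apply: pN.
    by rewrite subrr rnorm0 ltW.
  rewrite pZ// ger0_norm ?divr_ge0 ?(ltW r0) ?(ltW v0)// => h1.
  rewrite mulrAC ler_pdivlMr//; move: h1; rewrite mulrAC ler_pdivrMr// => h1.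
  rewrite mulrC; apply: le_trans h1 _.
  by rewrite ler_wpM2r ?ler_norm// ltW.
have step (nx : nat * (V * {posnum R})) : exists yr : V * {posnum R},
    (forall z, rnorm (z - yr.1) <= yr.2%:num -> rnorm (z - nx.2.1) <= nx.2.2%:num) /\
    exists t, [/\ 0 < t, t < nx.1.+1%:R^-1 &
      forall z, rnorm (z - yr.1) <= yr.2%:num -> nx.1%:R < p t z].
  case: nx => n [x r] /=.
  have n0 : 0 < n.+1%:R^-1 :> R by rewrite invr_gt0.
  have r20 : 0 < r%:num / 2 by rewrite divr_gt0.
  have [t [y [t0 td yx Np]]] := large _ x _ n%:R n0 r20.
  have [C pC] := pb t t0.
  (* On a ball of this radius around [y] the seminorm [p t] drops by at most half of its excess over
     [n], so it stays above [n]. *)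
  have s0 : 0 < Order.min (r%:num / 2) ((p t y - n%:R) / (2 * (`|C| + 1))).
    by rewrite lt_min r20 divr_gt0 ?subr_gt0// mulr_gt0// ltr_wpDl.
  exists (y, PosNum s0) => /=; split => [z|].
    rewrite le_min => /andP[zy _]; apply: le_trans (ler_rnorm_distD z y x) _; lra.
  exists t; split => // z; rewrite le_min => /andP[_].
  rewrite ler_pdivlMr ?mulr_gt0 ?ltr_wpDl// => zy.
  have := pD t z (y - z) t0; rewrite subrKC => py.
  have := pC (y - z); rewrite rnormB => pyz.
  have zy0 := rnorm_ge0 (z - y).
  have : C * rnorm (z - y) <= `|C| * rnorm (z - y).
    by rewrite ler_wpM2r// ler_norm.
  nra.
have [f fP] := choice step.
pose s := fix s n := if n is m.+1 then f (m, s m) else (0 : V, PosNum (@ltr01 R)).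
have [|||||z zP] := @nested_convex _ V b bi
    (fun n => [set v | rnorm (v - (s n).1) <= (s n).2%:num]) 1.
- by move=> n; exists (s n).1 => /=; rewrite subrr rnorm0.
- by move=> n v /= vn; have [+ _] := fP (n, s n); apply.
- move=> n x y /= xs ys.
  have -> : 2^-1%:C *: (x + y) - (s n).1 =
      2^-1%:C *: ((x - (s n).1) + (y - (s n).1)).
    rewrite addrACA -opprD scalerBr; congr (_ - _).
    rewrite -(mulr2n (s n).1) -(scaler_nat 2 (s n).1) scalerA.
    by rewrite -(rmorph_nat (real_complex R)) -rmorphM mulVf// scale1r.
  rewrite rnormZr ger0_norm ?invr_ge0//.
  have := ler_rnormD (x - (s n).1) (y - (s n).1); lra.
- move=> n v h /=; apply/ler_addgt0Pr => e e0.
  have [w /= ws vw] := h _ e0.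
  have := ler_rnorm_distD v w (s n).1; lra.
- by move=> v /=; rewrite subr0.
have [M [d [d0 Md]]] := pw z.
(* The first entry gives [n > |M|]; the second gives [n.+1%:R^-1 <= d], so that the time [t] of step
   [n] falls where [p t z <= M]. *)
pose n := maxn (truncn `|M|).+1 (truncn d^-1).
have [_ [t [t0 tn /(_ z)]]] := fP (n, s n).
move=> /(_ (zP n.+1)) /= np.
have : p t z <= M.
  apply: Md => //; apply: lt_le_trans tn _ => /=.
  rewrite -[leRHS]invrK lef_pV2 ?posrE ?invr_gt0//.
  apply: (@le_trans _ _ (truncn d^-1).+1%:R); first exact/ltW/truncnS_gt.
  by rewrite ler_nat ltnS leq_maxr.
apply/negP; rewrite -ltNge; apply: le_lt_trans np.
apply: le_trans (ler_norm M) _; apply: (@le_trans _ _ (truncn `|M|).+1%:R).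
  exact/ltW/truncnS_gt.
by rewrite ler_nat leq_maxl.
Qed.

End uniform_boundedness.

Section dini.
Context (R : realType).
Implicit Types (phi : R -> R) (t h e K : R).

Lemma near_right0P (P : R -> Prop) : (\forall h \near 0^'+, P h) <->
  exists2 d : R, 0 < d & forall h, 0 < h -> h < d -> P h.
Proof.
split=> [|[d d0 dP]].
  move=> [d /= d0 dP]; exists d => // h h0 hd; apply: dP => //=.
  by rewrite sub0r normrN gtr0_norm.
exists d => //= h /=; rewrite sub0r normrN => hd h0; apply: dP => //.
exact: le_lt_trans (ler_norm _) hd.
Qed.

(* The increment condition says that the upper right Dini derivative of [phi] is
   nonpositive, the other one that [phi] is lower semicontinuous from the left. *)
Lemma dini_nonincreasing phi (tau : R) :
  (forall t, 0 <= t -> t < tau -> forall e, 0 < e ->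
    \forall h \near 0^'+, phi (t + h) <= phi t + h * e) ->
  (forall t, 0 < t -> t < tau -> forall e, 0 < e ->
    \forall h \near 0^'+, phi t <= phi (t - h) + e) ->
  forall t, 0 <= t -> t < tau -> phi t <= phi 0.
Proof.
move=> phiD phiL t t0 ttau.
suff H e : 0 < e -> phi t <= phi 0 + e * t.
  have [->//|tn0] := eqVneq t 0.
  have {}t0 : 0 < t by rewrite lt_neqAle eq_sym tn0.
  apply/ler_addgt0Pr => e e0.
  by have := H (e / t) (divr_gt0 e0 t0); rewrite divfK// gt_eqF.
move=> e0.
(* Continuous induction: left semicontinuity puts [sup A] into [A], and the increment condition
   pushes beyond it unless [sup A = t]. *)
pose A := [set s | [/\ 0 <= s, s <= t & forall r, 0 <= r -> r <= s -> phi r <= phi 0 + e * r]].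
have A0 : A 0.
  split=> // r r0 r0'; have -> : r = 0 by apply/eqP; rewrite eq_le r0 r0'.
  by rewrite mulr0 addr0.
have supA : has_sup A by split; [exists 0|exists t => s []].
pose s := sup A.
have s0 : 0 <= s by apply: ub_le_sup => //; case: supA.
have st : s <= t by apply: sup_le_ub; [exists 0|move=> r []].
have lts r : 0 <= r -> r < s -> phi r <= phi 0 + e * r.
  move=> r0 rs; have sr : 0 < s - r by rewrite subr_gt0.
  have [x [x0 xt xP] sx] := sup_adherent sr supA.
  by apply: xP => //; rewrite ltW//; move: sx; rewrite -/s; lra.
have As : A s.
  split => // r r0; rewrite le_eqVlt => /predU1P[->|]; last exact: lts.
  have [->|sn0] := eqVneq s 0; first by rewrite mulr0 addr0.
  have {}s0 : 0 < s by rewrite lt_neqAle eq_sym sn0.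
  apply/ler_addgt0Pr => d d0.
  have /near_right0P[c c0 cP] := phiL s s0 (le_lt_trans st ttau) _ d0.
  pose h := Order.min (c / 2) (s / 2).
  have h0 : 0 < h by rewrite lt_min !divr_gt0.
  have hc : h < c.
    by apply: (@le_lt_trans _ _ (c / 2)); rewrite ?ge_min ?lexx// ltr_pdivrMr//; lra.
  have hs : h < s.
    apply: (@le_lt_trans _ _ (s / 2)); rewrite ?ge_min ?lexx ?orbT//.
    by rewrite ltr_pdivrMr//; lra.
  have := cP h h0 hc; have := lts (s - h).
  rewrite subr_ge0 (ltW hs) ltrBlDr ltrDl => /(_ isT h0); nra.
move: (st); rewrite le_eqVlt => /predU1P[ste|lst].
  by case: As => _ _; rewrite ste; apply.
have /near_right0P[c c0 cP] := phiD s s0 (le_lt_trans st ttau) _ e0.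
pose h := Order.min (c / 2) (t - s).
have h0 : 0 < h by rewrite lt_min divr_gt0//= subr_gt0.
have hc : h < c.
  by apply: (@le_lt_trans _ _ (c / 2)); rewrite ?ge_min ?lexx// ltr_pdivrMr//; lra.
have ht : h <= t - s by rewrite /h ge_min lexx orbT.
have : A (s + h).
  split; [lra|lra|] => r r0 rsh.
  have [rs|sr] := leP r s; first by case: As => _ _; apply.
  have := cP (r - s); rewrite subr_gt0 subrKC => /(_ sr) H.
  have {}H : phi r <= phi s + (r - s) * e by apply: H; lra.
  have : phi s <= phi 0 + e * s by case: As => _ _; apply.
  nra.
by move=> /(ub_le_sup supA.2); rewrite -/s; lra.
Qed.

(** The integrating factor [exp (- K t)] reduces this to [dini_nonincreasing]: the term [K * phi t]
    is absorbed by [1 + K h <= exp (K h)]. *)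
Lemma dini_gronwall phi (tau K : R) : 0 <= K -> (forall t, 0 <= phi t) ->
  (forall t, 0 <= t -> t < tau -> forall e, 0 < e ->
    \forall h \near 0^'+, phi (t + h) <= phi t + h * (K * phi t + e)) ->
  (forall t, 0 < t -> t < tau -> forall e, 0 < e ->
    \forall h \near 0^'+, phi t <= phi (t - h) + e) ->
  forall t, 0 <= t -> t < tau -> phi t <= expR (K * t) * phi 0.
Proof.
move=> K0 phi0 phiD phiL t t0 ttau.
pose psi t := expR (- (K * t)) * phi t.
have E1 s : 0 <= s -> expR (- (K * s)) <= 1.
  by move=> s0; rewrite -expR0 ler_expR oppr_le0 mulr_ge0.
suff : psi t <= psi 0.
  rewrite /psi mulr0 oppr0 expR0 mul1r expRN mulrC ler_pdivrMr ?expR_gt0//.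
  by rewrite mulrC.
apply: (dini_nonincreasing (tau := tau)) => // {ttau t0}t t0 ttau e e0.
- have := phiD t t0 ttau e e0; rewrite !near_right0P => -[d d0 dP].
  exists d => // h h0 hd; have {dP} := dP h h0 hd => H.
  rewrite /psi mulrDr opprD expRD.
  apply: (@le_trans _ _ (expR (- (K * t)) * expR (- (K * h)) *
     ((1 + K * h) * phi t + h * e))).
    by rewrite ler_wpM2l ?mulr_ge0 ?expR_ge0//; lra.
  rewrite mulrDr lerD//.
    rewrite -mulrA ler_wpM2l ?expR_ge0// mulrA ler_piMl//.
    rewrite expRN mulrC ler_pdivrMr ?expR_gt0// mul1r.
    exact: expR_ge1Dx.
  rewrite ler_piMl ?mulr_ge0 ?(ltW h0) ?(ltW e0)//.
  by rewrite mulr_ile1 ?expR_ge0 ?E1 ?(ltW h0).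
- have := phiL t t0 ttau e e0; rewrite !near_right0P => -[d d0 dP].
  exists d => // h h0 hd; have {dP} := dP h h0 hd => H.
  rewrite /psi; apply: (@le_trans _ _ (expR (- (K * t)) * (phi (t - h) + e))).
    by rewrite ler_wpM2l ?expR_ge0.
  rewrite mulrDr lerD//; last by rewrite ler_piMl ?(ltW e0) ?E1 ?(ltW t0).
  rewrite ler_wpM2r// ler_expR lerN2 ler_wpM2l//; lra.
Qed.

End dini.

(** * Invariance of convex sets under form semigroups *)

(** Transfers left lower semicontinuity from a norm to its square, the quantity to which
    [dini_gronwall] is applied. *)
Lemma ler_sqr_eps (R : realFieldType) (a e : R) : 0 <= a -> 0 < e ->
  exists2 d : R, 0 < d & forall c, 0 <= c -> a <= c + d -> a ^+ 2 <= c ^+ 2 + e.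
Proof.
move=> a0 e0; have a10 : 0 < 2 * a + 1 by rewrite ltr_wpDl// mulr_ge0.
exists (Order.min 1 (e / (2 * a + 1))); first by rewrite lt_min ltr01 divr_gt0.
set d := Order.min _ _ => c c0 acd.
have d0 : 0 < d by rewrite lt_min ltr01 divr_gt0.
have d1 : d <= 1 by rewrite ge_min lexx.
have de : d * (2 * a + 1) <= e by rewrite -ler_pdivlMr// ge_min lexx orbT.
have [ac|ca] := leP a c; first by nra.
nra.
Qed.

Lemma ler_add_invS (R : realType) (x y : R) :
  (forall n : nat, x <= y + n.+1%:R^-1) -> x <= y.
Proof.
move=> h; rewrite leNgt; apply/negP => yx.
have d0 : 0 < x - y by rewrite subr_gt0.
have := h (truncn (x - y)^-1); rewrite -lerBlDl; apply/negP; rewrite -ltNge.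
by rewrite invf_plt ?posrE// truncnS_gt.
Qed.

(** * Resolvents, orbits and quasi-contractivity *)

Section form_semigroup.
Context (R : realType) (X : normedModType R[i]) (V : completeNormedModType R[i]).
Variables (bX : X -> X -> R) (bV : V -> V -> R).
Hypotheses (bXi : real_inner bX) (bVi : real_inner bV).
Variables (j : {linear V -> X}) (Mj : R).
Hypothesis j_le : forall v, rnorm (j v) <= Mj * rnorm v.
Hypothesis j_dense : forall x (e : R), 0 < e -> exists v, rnorm (x - j v) < e.
Variables (al : V -> V -> R) (M kappa omega : R).
Hypotheses (al_bil : rbilinear al) (al_bd : rbibounded al M).
Hypotheses (kappa0 : 0 < kappa) (omega0 : 0 <= omega).
Hypothesis al_ell :
  forall u, kappa * rnorm u ^+ 2 <= al u u + omega * rnorm (j u) ^+ 2.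
Variable S : R -> X -> X.
Hypothesis S_lin : forall (t c : R) x y, 0 < t ->
  S t (c%:C *: x + y) = c%:C *: S t x + S t y.
Hypothesis S_bd : forall t : R, 0 < t -> exists C, forall x, rnorm (S t x) <= C * rnorm x.
Hypothesis S_add : forall (s t : R) x, 0 < s -> 0 < t -> S (s + t) x = S s (S t x).
Hypothesis S_cvg : forall x (e : R), 0 < e -> \forall t \near 0^'+, rnorm (S t x - x) < e.

Definition derivative_at0 (x y : X) := forall e : R, 0 < e ->
  \forall h \near 0^'+, rnorm (S h x - x - h%:C *: y) <= h * e.

Hypothesis S_gen : forall x y, derivative_at0 x y <->
  exists2 u, j u = x & forall v, al u v = - bX y (j v).

Let bXb := real_inner_bil bXi.

Let M_ge0 : rbibounded al `|M|. Proof. exact: rbibounded_norm. Qed.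

Let j_le_norm v : rnorm (j v) <= `|Mj| * rnorm v.
Proof. by apply: le_trans (j_le v) _; rewrite ler_wpM2r ?rnorm_ge0 ?ler_norm. Qed.

Let al_ge u : - (omega * rnorm (j u) ^+ 2) <= al u u.
Proof.
by have := al_ell u; have := mulr_ge0 (ltW kappa0) (sqr_ge0 (rnorm u)); lra.
Qed.

Let S_D t x y : 0 < t -> S t (x + y) = S t x + S t y.
Proof. by move=> t0; have := S_lin 1 x y t0; rewrite !scale1r. Qed.

Let S_0 t : 0 < t -> S t 0 = 0.
Proof.
by move=> t0; have := S_D 0 0 t0; rewrite addr0 => /eqP; rewrite -subr_eq0 opprD
  addNKr oppr_eq0 => /eqP.
Qed.

Let S_Z t c x : 0 < t -> S t (c%:C *: x) = c%:C *: S t x.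
Proof. by move=> t0; have := S_lin c x 0 t0; rewrite !addr0 S_0// addr0. Qed.

Let S_B t x y : 0 < t -> S t (x - y) = S t x - S t y.
Proof.
move=> t0; rewrite S_D//; congr (_ + _); have := S_Z (-1) y t0.
by rewrite rmorphN rmorph1 !scaleN1r.
Qed.

Lemma derivative_at0_S x y t : 0 < t -> derivative_at0 x y ->
  derivative_at0 (S t x) (S t y).
Proof.
move=> t0 xy e e0; have [C SC] := S_bd t0.
have C0 : 0 < `|C| + 1 by rewrite ltr_wpDl.
have := xy _ (divr_gt0 e0 C0); rewrite !near_right0P => -[d d0 dP].
exists d => // h h0 hd; have := dP h h0 hd.
have -> : S h (S t x) = S t (S h x) by rewrite -!S_add// addrC.
rewrite -S_Z// -!S_B// mulrA ler_pdivlMr// => H.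
apply: le_trans (SC _) _; rewrite mulrC; apply: le_trans H.
rewrite ler_wpM2l ?rnorm_ge0//; have := ler_norm C; lra.
Qed.

(* [j u = lam (lam + A)^-1 f] *)
Definition resolvent_at lam f u := forall v, al u v = lam * bX (f - j u) (j v).

(** Ellipticity makes [al u v + lam * bX (j u) (j v)] coercive on [V] as soon as [lam] reaches
    [omega], so Lax-Milgram applies. Its single constant adds the bound of the form to that of the
    functional. *)
Lemma resolvent_ex lam f : omega <= lam -> exists u, resolvent_at lam f u.
Proof.
move=> ol.
have lam0 : 0 <= lam by apply: le_trans ol.
have [||||||u uP] := @lax_milgram _ V bV bVi
  (fun u v => al u v + lam * bX (j u) (j v)) (fun v => lam * bX f (j v))
  kappa (`|M| + lam * `|Mj| ^+ 2 + lam * rnorm f * `|Mj|).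
- split=> [y t u v|u t x y]; rewrite !linearP/= !(rbE al_bil) !(rbE bXb); ring.
- by move=> t u v; rewrite linearP/= !(rbE bXb); ring.
- move=> u v; apply: le_trans (ler_normD _ _) _.
  have H1 := M_ge0 u v.
  have H2 := real_inner_norm_le bXi (j u) (j v).
  have H3 : rnorm (j u) * rnorm (j v) <= `|Mj| * rnorm u * (`|Mj| * rnorm v).
    by rewrite ler_pM ?rnorm_ge0.
  rewrite normrM (ger0_norm lam0).
  have H4 : lam * `|bX (j u) (j v)| <= lam * (`|Mj| * rnorm u * (`|Mj| * rnorm v)).
    by rewrite ler_wpM2l//; apply: le_trans H3.
  have : 0 <= lam * rnorm f * `|Mj| * (rnorm u * rnorm v).
    by rewrite !mulr_ge0 ?rnorm_ge0.
  lra.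
- move=> v; rewrite normrM (ger0_norm lam0).
  have H2 := real_inner_norm_le bXi f (j v).
  have H3 : rnorm f * rnorm (j v) <= rnorm f * (`|Mj| * rnorm v).
    by rewrite ler_wpM2l ?rnorm_ge0.
  have H4 : lam * `|bX f (j v)| <= lam * (rnorm f * (`|Mj| * rnorm v)).
    by rewrite ler_wpM2l//; apply: le_trans H3.
  have : 0 <= (`|M| + lam * `|Mj| ^+ 2) * rnorm v.
    by rewrite mulr_ge0 ?rnorm_ge0// addr_ge0// mulr_ge0// exprn_ge0.
  lra.
- by [].
- move=> v; apply: le_trans (al_ell v) _; rewrite (real_innerxx bXi) lerD2l.
  by rewrite ler_wpM2r// sqr_ge0.
by exists u => v; rewrite (rbBl bXb) mulrBr -uP addrK.
Qed.

Lemma resolvent_at_der lam f u : resolvent_at lam f u ->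
  derivative_at0 (j u) (lam%:C *: (j u - f)).
Proof.
move=> uP; apply/S_gen; exists u => // v.
by rewrite uP !(rbE bXb); ring.
Qed.

Lemma resolvent_atB lam f g u v : resolvent_at lam f u -> resolvent_at lam g v ->
  resolvent_at lam (f - g) (u - v).
Proof.
by move=> uf vg w; rewrite (rbBl al_bil) uf vg linearB/= !(rbE bXb); ring.
Qed.

(** Testing the equation with [u] gives [(lam - omega) * rnorm (j u) <= lam * rnorm f], and
    [lam <= 2 * (lam - omega)]. *)
Lemma resolvent_le lam f u : 0 < lam -> 2 * omega <= lam -> resolvent_at lam f u ->
  rnorm (j u) <= 2 * rnorm f.
Proof.
move=> lam0 ol uf; have := uf u; rewrite (rbBl bXb) (real_innerxx bXi) => E.
have := al_ge u; have := real_inner_le bXi f (j u) => H1 H2.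
have [->|u0] := eqVneq (rnorm (j u)) 0; first by rewrite mulr_ge0 ?rnorm_ge0.
have {}u0 : 0 < rnorm (j u) by rewrite lt_neqAle eq_sym u0 rnorm_ge0.
rewrite -(ler_pM2r u0) -(ler_pM2l lam0).
have H3 : lam * bX f (j u) <= lam * (rnorm f * rnorm (j u)) by rewrite ler_pM2l.
have H4 : 2 * omega * rnorm (j u) ^+ 2 <= lam * rnorm (j u) ^+ 2.
  by rewrite ler_wpM2r// sqr_ge0.
lra.
Qed.

Lemma resolvent_cvg_range v (e : R) : 0 < e -> exists L, forall lam u, L <= lam ->
  resolvent_at lam (j v) u -> rnorm (j u - j v) < e.
Proof.
move=> e0.
(* Testing with [u - v] gives [lam * rnorm (j u - j v) ^+ 2 = al u v - al u u]. [K] bounds the right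
   side uniformly in [lam]: ellipticity absorbs the growth of [al u v] in [u], and [resolvent_le]
   bounds [rnorm (j u)]. *)
pose K := omega * (2 * rnorm (j v)) ^+ 2 + (`|M| * rnorm v) ^+ 2 / kappa.
exists (Order.max (2 * omega) ((K + 1) / e ^+ 2)) => lam u; rewrite ge_max => /andP[ol Kl].
have K0 : 0 <= K.
  by apply: addr_ge0; [exact: mulr_ge0 (sqr_ge0 _)|exact: divr_ge0 (sqr_ge0 _) (ltW _)].
have lam0 : 0 < lam by apply: lt_le_trans Kl; rewrite divr_gt0 ?exprn_gt0 ?ltr_wpDl.
move=> uv; have := uv (u - v); rewrite linearB/=.
have -> : bX (j v - j u) (j u - j v) = - rnorm (j u - j v) ^+ 2.
  by rewrite -(real_innerxx bXi) !(rbE bXb) (real_innerC bXi (j v)); ring.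
rewrite (rbBr al_bil) => E.
have H1 := al_ell u; have H2 := resolvent_le lam0 ol uv.
have H3 : omega * rnorm (j u) ^+ 2 <= omega * (2 * rnorm (j v)) ^+ 2.
  by rewrite ler_wpM2l// lerXn2r ?nnegrE ?mulr_ge0 ?rnorm_ge0.
have H4 : al u v <= `|M| * rnorm u * rnorm v := le_trans (ler_norm _) (M_ge0 u v).
have H5 : `|M| * rnorm u * rnorm v - kappa * rnorm u ^+ 2
    <= (`|M| * rnorm v) ^+ 2 / kappa.
  rewrite ler_pdivlMr//.
  have := sqr_ge0 (kappa * rnorm u - `|M| * rnorm v / 2).
  have := sqr_ge0 (`|M| * rnorm v); nra.
have : lam * rnorm (j u - j v) ^+ 2 <= K by rewrite /K; lra.
move: Kl; rewrite ler_pdivrMr ?exprn_gt0// => Kl H.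
rewrite -(ltr_pXn2r (n := 2))// ?nnegrE ?rnorm_ge0 ?(ltW e0)//.
rewrite -(ltr_pM2l lam0); lra.
Qed.

Lemma resolvent_cvg f (e : R) : 0 < e -> exists L, forall lam u, L <= lam ->
  resolvent_at lam f u -> rnorm (j u - f) < e.
Proof.
(* The distance from [f] to the dense range counts three times, twice through the factor 2 of
   [resolvent_le]; the fourth quarter is the error for [j v]. *)
move=> e0; have e4 : 0 < e / 4 by rewrite divr_gt0.
have [v fv] := j_dense f e4.
have [L LP] := resolvent_cvg_range v e4.
exists (Order.max L (2 * omega + 1)) => lam u; rewrite ge_max => /andP[Ll ol] uf.
have o0 := omega0; have ol' : omega <= lam by lra.
have lam0 : 0 < lam by lra.
have [w wv] := resolvent_ex (j v) ol'.
have H1 := LP lam w Ll wv.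
have ol2 : 2 * omega <= lam by lra.
have := resolvent_le lam0 ol2 (resolvent_atB uf wv); rewrite linearB/= => H2.
have := ler_rnorm_distD (j u) (j w) f; have := ler_rnorm_distD (j w) (j v) f.
have := rnormB (j v) f; lra.
Qed.

Lemma domain_dense x (e : R) : 0 < e ->
  exists y z, derivative_at0 y z /\ rnorm (x - y) < e.
Proof.
move=> e0; have [L LP] := resolvent_cvg x e0.
have [|u ux] := @resolvent_ex (Order.max L omega) x.
  by rewrite le_max lexx orbT.
exists (j u), ((Order.max L omega)%:C *: (j u - x)); split.
  exact: resolvent_at_der.
by rewrite rnormB; apply: LP ux; rewrite le_max lexx.
Qed.

(** Orbits starting in the domain converge in the stronger norm of [V]: by ellipticity,
    [rnorm (w - u)] is controlled by the distances of [S h y] to [y] and of [S h (j u)] to [j u]. *)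
Lemma form_cvg_S u y (e : R) : 0 < e -> (forall v, al u v = - bX y (j v)) ->
  \forall h \near 0^'+, exists2 w, j w = S h (j u) & rnorm (w - u) < e.
Proof.
move=> e0 uy.
(* If both distances in [X] are below [e * c], ellipticity bounds [kappa * rnorm (w - u) ^+ 2] by
   [(1 + omega) * (e * c) ^+ 2], and [(1 + omega) * c ^+ 2 <= kappa]. *)
pose c := Order.min 1 (kappa / (1 + omega)).
have o1 : 0 < 1 + omega by rewrite ltr_pwDl.
have c0 : 0 < c by rewrite lt_min ltr01 divr_gt0.
have ec0 : 0 < e * c by rewrite mulr_gt0.
have cP : (1 + omega) * c ^+ 2 <= kappa.
  have c1 : c <= 1 by rewrite ge_min lexx.
  have : c <= kappa / (1 + omega) by rewrite ge_min lexx orbT.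
  rewrite ler_pdivlMr// => ck; apply: le_trans ck.
  by rewrite mulrC ler_wpM2r ?(ltW o1)// expr2 ler_piMl ?(ltW c0).
have d1 := S_cvg y ec0; have d2 := S_cvg (j u) ec0.
have dju : derivative_at0 (j u) y by apply/S_gen; exists u.
near=> h.
have h0 : 0 < h by [].
have /S_gen[w jw wP] := derivative_at0_S h0 dju.
exists w => //.
have E : al (w - u) (w - u) = - bX (S h y - y) (S h (j u) - j u).
  by rewrite (rbBl al_bil) wP uy -jw linearB/= !(rbE bXb); ring.
have H1 := al_ell (w - u); rewrite E linearB/= jw in H1.
have H2 := real_inner_norm_le bXi (S h y - y) (S h (j u) - j u).
have Hy : rnorm (S h y - y) < e * c by near: h.
have Hu : rnorm (S h (j u) - j u) < e * c by near: h.
have H3 : rnorm (S h y - y) * rnorm (S h (j u) - j u) < (e * c) ^+ 2.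
  by rewrite expr2 ltr_pM ?rnorm_ge0.
have H4 : omega * rnorm (S h (j u) - j u) ^+ 2 <= omega * (e * c) ^+ 2.
  by rewrite ler_wpM2l// lerXn2r ?nnegrE ?rnorm_ge0 ?(ltW ec0)// ltW.
move: H2; rewrite ler_norml => /andP[H2 _].
rewrite -(ltr_pXn2r (n := 2))// ?nnegrE ?rnorm_ge0 ?(ltW e0)//.
rewrite -(ltr_pM2l kappa0).
have : (1 + omega) * c ^+ 2 * e ^+ 2 <= kappa * e ^+ 2.
  by rewrite ler_wpM2r ?sqr_ge0.
rewrite exprMn in H3 H4; lra.
Unshelve. all: by end_near. Qed.

(* [X] is not assumed to be complete, so Banach-Steinhaus is applied to the
   operators [S t \o j] on [V]. *)
Lemma S_locally_bounded : exists C d, [/\ 0 <= C, 0 < d &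
  forall t v, 0 < t -> t < d -> rnorm (S t (j v)) <= C * rnorm v].
Proof.
apply: (@uniform_boundedness _ V bV bVi (fun t v => rnorm (S t (j v)))).
- move=> t t0; have [C SC] := S_bd t0; exists (`|C| * `|Mj|) => v.
  apply: le_trans (SC _) _; apply: (@le_trans _ _ (`|C| * rnorm (j v))).
    by rewrite ler_wpM2r ?rnorm_ge0 ?ler_norm.
  by rewrite -mulrA ler_wpM2l.
- by move=> t v w t0; rewrite linearD/= S_D// ler_rnormD.
- by move=> t s v t0; rewrite linearZ/= S_Z// rnormZr.
- move=> v; have /near_right0P[d d0 dP] := S_cvg (j v) ltr01.
  exists (rnorm (j v) + 1), d; split => // t t0 td.
  have := dP t t0 td; have := rnorm_sub_norm (S t (j v)) (j v); lra.
Qed.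

Lemma sqr_dist_step x y c (e : R) : 0 < e -> derivative_at0 x y ->
  \forall h \near 0^'+,
    rnorm (S h x - c) ^+ 2 <= rnorm (x - c) ^+ 2 + h * (2 * bX y (x - c) + e).
Proof.
move=> e0 xy.
(* The error [e] is halved: [e1] is chosen so that the remainder paired with [x - c] costs at most
   [h * (e / 2)], and the squared increment, at most [h ^+ 2 * N ^+ 2], takes the other half. *)
pose D := 2 * rnorm (x - c) + 1.
have D0 : 0 < D by rewrite ltr_wpDl// mulr_ge0 ?rnorm_ge0.
pose e1 := e / (2 * D).
have e10 : 0 < e1 by rewrite divr_gt0// mulr_gt0.
pose N := rnorm y + e1.
have N0 : 0 < N by rewrite ltr_wpDl ?rnorm_ge0.
have hN : \forall h \near 0^'+, h * N ^+ 2 < e / 2.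
  apply/near_right0P; exists (e / 2 / N ^+ 2); first by rewrite !divr_gt0 ?exprn_gt0.
  by move=> h h0; rewrite ltr_pdivlMr ?exprn_gt0.
have xy1 := xy e1 e10.
near=> h.
have h0 : 0 < h by [].
have Hr : rnorm (S h x - x - h%:C *: y) <= h * e1 by near: h.
have HN : h * N ^+ 2 < e / 2 by near: h.
set r := S h x - x - h%:C *: y in Hr.
have -> : S h x - c = (x - c) + (h%:C *: y + r).
  by rewrite /r [h%:C *: y + _]addrC subrK [RHS]addrC addrA subrK.
rewrite (rnormD_sqr bXi) (rbDr bXb (x - c) (h%:C *: y)) (rbZr bXb) (real_innerC bXi (x - c) y).
have H1 : rnorm (h%:C *: y + r) <= h * N.
  apply: le_trans (ler_rnormD _ _) _; rewrite rnormZr (gtr0_norm h0) /N.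
  by rewrite mulrDr lerD2l.
have H2 : rnorm (h%:C *: y + r) ^+ 2 <= h * (e / 2).
  apply: (@le_trans _ _ ((h * N) ^+ 2)).
    by rewrite lerXn2r ?nnegrE ?rnorm_ge0 ?mulr_ge0 ?(ltW h0) ?(ltW N0).
  by rewrite exprMn expr2 -mulrA ler_pM2l// ltW.
have H3 := real_inner_le bXi (x - c) r.
have H4 : rnorm (x - c) * rnorm r <= rnorm (x - c) * (h * e1).
  by rewrite ler_wpM2l ?rnorm_ge0.
have H5 : D * e1 = e / 2 by rewrite /e1; field; rewrite gt_eqF.
have H6 : 2 * rnorm (x - c) * e1 <= e / 2 by rewrite -H5 /D; lra.
have H7 : h * (2 * rnorm (x - c) * e1) <= h * (e / 2) by rewrite ler_pM2l.
lra.
Unshelve. all: by end_near. Qed.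

(** [S 0] is an arbitrary value, whereas the Dini lemmas start at time 0. *)
Let orbit t x := if 0 < t then S t x else x.

Let orbitD t h x : 0 <= t -> 0 < h -> orbit (t + h) x = S h (orbit t x).
Proof.
move=> t0 h0; rewrite /orbit; have th : 0 < t + h by rewrite ltr_wpDl.
rewrite th; case: ifPn => [tp|]; first by rewrite addrC S_add.
rewrite -leNgt => t0'; suff -> : t = 0 by rewrite add0r.
by apply/eqP; rewrite eq_le t0 t0'.
Qed.

Let orbit0 x : orbit 0 x = x. Proof. by rewrite /orbit ltxx. Qed.

Let orbit_der t x y : 0 <= t -> derivative_at0 x y ->
  derivative_at0 (orbit t x) (orbit t y).
Proof. by rewrite /orbit; case: ifPn => // t0 _; exact: derivative_at0_S. Qed.

Let al_der x y : derivative_at0 x y -> bX y x <= omega * rnorm x ^+ 2.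
Proof.
by move=> /S_gen[u <- /(_ u) uu]; have := al_ge u; rewrite uu lerN2.
Qed.

Let orbit_dini t x y c (e : R) : 0 <= t -> 0 < e -> derivative_at0 x y ->
  \forall h \near 0^'+, rnorm (orbit (t + h) x - c) ^+ 2 <=
    rnorm (orbit t x - c) ^+ 2 + h * (2 * bX (orbit t y) (orbit t x - c) + e).
Proof.
move=> t0 e0 xy; have := sqr_dist_step c e0 (orbit_der t0 xy).
rewrite !near_right0P => -[d d0 dP]; exists d => // h h0 hd.
by rewrite orbitD//; exact: dP.
Qed.

(** On the domain, the squared norm of the orbit satisfies the Gronwall inequality with constant
    [2 * omega]. Its left semicontinuity rests on [S s x - S (s - h) x = S (s - h) (S h x - x)]: for
    small times [S_locally_bounded] controls this by a norm in [V], which [form_cvg_S] makes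
    small. *)
Let contraction_local : exists2 d, 0 < d & forall t x, 0 < t -> t < d ->
  rnorm (S t x) <= expR (omega * t) * rnorm x.
Proof.
have [C [d [C0 d0 CP]]] := S_locally_bounded; exists d => //.
suff H x y t : derivative_at0 x y -> 0 < t -> t < d ->
    rnorm (S t x) <= expR (omega * t) * rnorm x.
  move=> t x t0 td; apply/ler_addgt0Pr => e e0.
  have [D SD] := S_bd t0.
  (* Replacing [x] by [y] in the domain costs [|D|] times the distance under [S t] and
     [exp (omega t)] times the distance in the bound for [y]. *)
  have K0 : 0 < expR (omega * t) + `|D| by rewrite ltr_pwDl ?expR_gt0.
  have [y [z [yz xy]]] := domain_dense x (divr_gt0 e0 K0).
  rewrite ltr_pdivlMr// in xy.
  have H1 := H _ _ _ yz t0 td.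
  have H2 := ler_rnormD (S t (x - y)) (S t y); rewrite -S_D// subrK in H2.
  have H3 : rnorm (S t (x - y)) <= `|D| * rnorm (x - y).
    by apply: le_trans (SD _) _; rewrite ler_wpM2r ?rnorm_ge0 ?ler_norm.
  have H4 : rnorm y <= rnorm x + rnorm (x - y).
    by have := rnorm_sub_norm y x; rewrite rnormB; lra.
  have H5 : expR (omega * t) * rnorm y <= expR (omega * t) * (rnorm x + rnorm (x - y)).
    by rewrite ler_wpM2l ?expR_ge0.
  lra.
move=> xy t0 td.
suff : rnorm (orbit t x) ^+ 2 <= expR (2 * omega * t) * rnorm (orbit 0 x) ^+ 2.
  rewrite orbit0 /orbit t0 => H.
  rewrite -(ler_pXn2r (n := 2))// ?nnegrE ?mulr_ge0 ?rnorm_ge0 ?expR_ge0//.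
  by rewrite exprMn -expRM_natl mulrA.
apply: (@dini_gronwall _ (fun t => rnorm (orbit t x) ^+ 2) d (2 * omega)) => //.
- by rewrite mulr_ge0.
- by move=> s; exact: sqr_ge0.
- move=> s s0 sd e e0; have := orbit_dini 0 s0 e0 xy.
  rewrite !near_right0P => -[c c0 cP]; exists c => // h h0 hc.
  have := cP h h0 hc; rewrite !subr0 => /le_trans; apply.
  rewrite lerD2l ler_pM2l// lerD2r -mulrA ler_pM2l//.
  exact/al_der/orbit_der.
- move=> s s0 sd e e0.
  have /S_gen[u ju uy] := xy.
  have [c c0 cP] := ler_sqr_eps (rnorm_ge0 (orbit s x)) e0.
  have C10 : 0 < C + 1 by rewrite ltr_wpDl.
  have := form_cvg_S (divr_gt0 c0 C10) uy.
  rewrite !near_right0P => -[c' c'0 c'P]; exists (Order.min c' s).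
    by rewrite lt_min c'0.
  move=> h h0; rewrite lt_min => /andP[hc' hs].
  have [w jw wu] := c'P h h0 hc'.
  have sh0 : 0 < s - h by rewrite subr_gt0.
  apply: cP; first exact: rnorm_ge0.
  rewrite /orbit s0 sh0 addrC -lerBlDr; apply: le_trans (rnorm_sub_norm _ _) _.
  have -> : S s x = S (s - h) (S h x) by rewrite -S_add// subrK.
  rewrite -S_B// -{2}ju -ju -jw -linearB/=; apply: le_trans (CP _ _ sh0 _) _.
    by apply: lt_trans sd; rewrite ltrBlDr ltrDl.
  move: wu; rewrite ltr_pdivlMr// => wu.
  by have := rnorm_ge0 (w - u); lra.
- exact: ltW.
Qed.

(** The exponential bound is multiplicative, so [S t = S (t / 2) S (t / 2)] doubles the interval on
    which it holds. *)
Lemma quasi_contraction t x : 0 < t -> rnorm (S t x) <= expR (omega * t) * rnorm x.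
Proof.
have [d d0 dP] := contraction_local.
suff H n : forall t x, 0 < t -> t < 2 ^+ n * d ->
    rnorm (S t x) <= expR (omega * t) * rnorm x.
  move=> t0; apply: (H (truncn (t / d)).+1) => //.
  rewrite -ltr_pdivrMr//; apply: lt_le_trans (truncnS_gt _) _.
  by rewrite -natrX ler_nat ltnW// ltn_expl.
elim: n => [|n IH] {}t {}x t0 td; first by apply: dP => //; rewrite mul1r in td.
have t20 : 0 < t / 2 by rewrite divr_gt0.
have t2d : t / 2 < 2 ^+ n * d by rewrite ltr_pdivrMr// mulrC mulrA -exprS.
rewrite {1 2}(splitr t) S_add// mulrDr expRD -mulrA.
apply: le_trans (IH _ _ t20 t2d) _.
by rewrite ler_wpM2l ?expR_ge0// IH.
Qed.

(** Write [S t x - S (t - h) x] as [S (t - h) (S h x - x)]; the norms of [S (t - h)] are at most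
    [exp (omega t)]. *)
Lemma S_left_cvg t x (e : R) : 0 < t -> 0 < e ->
  \forall h \near 0^'+, rnorm (S t x - S (t - h) x) <= e.
Proof.
move=> t0 e0; have E0 := expR_gt0 (omega * t).
have := S_cvg x (divr_gt0 e0 E0); rewrite !near_right0P => -[d d0 dP].
exists (Order.min d t); first by rewrite lt_min d0.
move=> h h0; rewrite lt_min => /andP[hd ht].
have th0 : 0 < t - h by rewrite subr_gt0.
have := dP h h0 hd; rewrite ltr_pdivlMr// => H.
have -> : S t x = S (t - h) (S h x) by rewrite -S_add// subrK.
rewrite -S_B//; apply: le_trans (quasi_contraction _ th0) _.
rewrite mulrC; apply: le_trans (ltW H); rewrite ler_wpM2l ?rnorm_ge0// ler_expR.
by rewrite ler_wpM2l// lerBlDr lerDl ltW.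
Qed.

(** * Invariance of a convex set and the form condition *)

Section invariance.
Variables (C : set X) (P : X -> X).
Hypothesis C_convex : forall x y (t : R), C x -> C y -> 0 <= t -> t <= 1 ->
  C (t%:C *: x + (1 - t)%:C *: y).
Hypothesis P_in : forall x, C (P x).
Hypothesis P_le : forall x y, C y -> rnorm (x - P x) <= rnorm (x - y).

Lemma projection_obtuse x y : C y -> bX (x - P x) (y - P x) <= 0.
Proof.
move=> Cy; rewrite leNgt; apply/negP => b0.
pose e := x - P x; pose g := y - P x.
rewrite -/e -/g in b0.
have G0 : 0 < rnorm g ^+ 2 + 1 by rewrite ltr_wpDl ?sqr_ge0.
(* Moving from [P x] towards [y] by [t] changes the squared distance by [- 2 t bX e g + t^2 |g|^2],
   which is negative for this [t]. *)
pose t := Order.min 1 (bX e g / (rnorm g ^+ 2 + 1)).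
have t0 : 0 < t by rewrite lt_min ltr01 divr_gt0.
have t1 : t <= 1 by rewrite ge_min lexx.
have tb : t * (rnorm g ^+ 2 + 1) <= bX e g.
  by rewrite -ler_pdivlMr// ge_min lexx orbT.
have := P_le x (C_convex Cy (P_in x) (ltW t0) t1).
have -> : x - (t%:C *: y + (1 - t)%:C *: P x) = e - t%:C *: g.
  rewrite /e /g rmorphB rmorph1 scalerBl scale1r scalerBr !opprD !opprK !addrA.
  by rewrite (addrAC x).
rewrite -/e -(ler_pXn2r (n := 2))// ?nnegrE ?rnorm_ge0// (rnormB_sqr bXi e).
rewrite rnormZr (gtr0_norm t0) (rbZr bXb) exprMn.
have : t * (t * (rnorm g ^+ 2 + 1)) <= t * bX e g by rewrite ler_pM2l.
have : 0 < t * bX e g by rewrite mulr_gt0.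
have := sqr_ge0 t; lra.
Qed.

Lemma projection_id x : rnorm (x - P x) <= 0 -> C x.
Proof.
move=> h; suff -> : x = P x by [].
apply/eqP; rewrite -subr_eq0; apply/eqP/rnorm0_eq0/eqP.
by rewrite eq_le h rnorm_ge0.
Qed.

(** With [x = j u] and [e = x - P x], the pairing of [S h x - x] with [e] is estimated twice. From
    below it is [h * lam * rnorm e ^+ 2] up to [o(h)], by the generator and the obtuse angle at
    [P x]. From above, [S h (P x)] stays in [C] and contributes nothing positive, so
    quasi-contractivity leaves [(exp (omega h) - 1) * rnorm e ^+ 2]. For [lam > 2 * omega] this
    forces [e = 0]. *)
Lemma invariant_resolvent lam f u :
  (forall t x, 0 < t -> C x -> C (S t x)) -> 0 < lam -> 2 * omega < lam ->
  C f -> resolvent_at lam f u -> C (j u).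
Proof.
move=> SC lam0 ol Cf uf.
set x := j u; pose e := x - P x.
have xy := resolvent_at_der uf; rewrite -/x in xy.
have Hf : rnorm e ^+ 2 <= bX (x - f) e.
  rewrite (real_innerC bXi) -(real_innerxx bXi).
  have := projection_obtuse x Cf; rewrite -/e.
  have -> : f - P x = e - (x - f) by rewrite /e opprB [RHS]addrC addrA subrK.
  by rewrite (rbBr bXb) subr_le0.
apply: projection_id; rewrite -/e.
have [->//|en0] := eqVneq (rnorm e) 0.
have {en0}e0 : 0 < rnorm e by rewrite lt_neqAle eq_sym en0 rnorm_ge0.
suff : (lam - 2 * omega) * rnorm e <= 0 by rewrite pmulr_rle0// subr_gt0.
apply/ler_addgt0Pr => d d0; rewrite add0r -(ler_pM2r e0).
have /near_right0P[c c0 cP] := xy d d0.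
have o10 : 0 < 2 * omega + 1 by rewrite ltr_wpDl// mulr_ge0.
(* The second bound gives [omega * h <= 1 / 2], where [exp s - 1 <= 2 s] for [s = omega * h]; hence
   the factor in [2 * omega < lam]. *)
pose h := Order.min (c / 2) (2 * omega + 1)^-1.
have h0 : 0 < h by rewrite lt_min divr_gt0 ?invr_gt0.
have hc : h < c.
  by apply: (@le_lt_trans _ _ (c / 2)); rewrite ?ge_min ?lexx// ltr_pdivrMr//; lra.
have ho : omega * h <= 1 / 2.
  have : h <= (2 * omega + 1)^-1 by rewrite ge_min lexx orbT.
  rewrite -(ler_pM2r o10) mulVf ?gt_eqF//; have := h0; nra.
have oh0 : 0 <= omega * h by rewrite mulr_ge0// ltW.
have expE : expR (omega * h) - 1 <= 2 * (omega * h).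
  have := expR_ge1Dx (- (omega * h)); rewrite expRN -subr_ge0.
  have E0 := expR_gt0 (omega * h).
  rewrite -(pmulr_lge0 _ E0) mulrBl mulVf ?gt_eqF//; nra.
have Hr := cP h h0 hc.
set r := S h x - x - _ in Hr.
have E1 : S h x - x = h%:C *: (lam%:C *: (x - f)) + r by rewrite /r subrKC.
have := real_inner_norm_le bXi r e; rewrite ler_norml => /andP[re _].
have Hre : rnorm r * rnorm e <= h * d * rnorm e by rewrite ler_pM2r.
have up : bX (S h x - x) e <= (expR (omega * h) - 1) * rnorm e ^+ 2.
  have -> : S h x - x = S h e - e + (S h (P x) - P x).
    by rewrite {1}/e S_B// /e opprB -addrA [X in _ = _ + X]addrC !subrKA.
  have Pob := projection_obtuse x (SC h (P x) h0 (P_in x)).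
  rewrite -/e (real_innerC bXi) in Pob.
  have He := real_inner_le bXi (S h e) e.
  have := quasi_contraction e h0 => Hq.
  have : rnorm (S h e) * rnorm e <= expR (omega * h) * rnorm e * rnorm e by rewrite ler_pM2r.
  rewrite (rbDl bXb) (rbBl bXb (S h e)) (real_innerxx bXi); lra.
have low : h * (lam * rnorm e ^+ 2) - h * d * rnorm e <= bX (S h x - x) e.
  rewrite E1 (rbDl bXb _ r) !(rbZl bXb).
  have : h * (lam * rnorm e ^+ 2) <= h * (lam * bX (x - f) e) by rewrite !ler_pM2l.
  lra.
have : (expR (omega * h) - 1) * rnorm e ^+ 2 <= 2 * (omega * h) * rnorm e ^+ 2.
  by rewrite ler_wpM2r ?sqr_ge0.
rewrite -(ler_pM2l h0); lra.
Qed.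

(** The limit of the resolvents in [V] is a common point of the sets [F1 <= 1 / (n + 1)],
    [F2 <= c2 n]: the first condition forces [j v = P (j u)], the second becomes
    [al v (v - u) <= 0]. *)
Lemma invariant_form u :
  (forall t x, 0 < t -> C x -> C (S t x)) ->
  exists2 v, j v = P (j u) & 0 <= al v (u - v).
Proof.
move=> SC; pose f := P (j u).
have res_le lam v : 0 < lam -> 2 * omega < lam -> resolvent_at lam f v ->
    al v v - al v u <= 0.
  move=> lam0 ol vf; have Cv := invariant_resolvent SC lam0 ol (P_in (j u)) vf.
  rewrite -(rbBr al_bil) vf linearB/= pmulr_rle0//.
  have := projection_obtuse (j u) Cv; rewrite -/f (real_innerC bXi).
  have -> : j v - j u = (j v - f) - (j u - f) by rewrite opprB addrA subrK.
  rewrite -[f - j v]opprB; move: (j v - f) (j u - f) => x y xy.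
  have := sqr_ge0 (rnorm x).
  rewrite (rbNl bXb) (rbBr bXb) (real_innerxx bXi); lra.
(* The shift by [omega] makes the quadratic part nonnegative, hence [F2] convex. It is paid back by
   the term [omega * rnorm f ^+ 2] of [c2], which is exact in the limit because [j v = f] there. *)
pose B v w := al v w + omega * bX (j v) (j w).
pose F1 v := rnorm (j v - f) ^+ 2.
pose F2 v := B v v - al v u.
have B_bil : rbilinear B.
  split=> [y t v w|v t w y]; rewrite /B !linearP/= !(rbE al_bil) !(rbE bXb); ring.
have jj_bd : rbibounded (fun v w => bX (j v) (j w)) (`|Mj| ^+ 2).
  move=> v w; apply: le_trans (real_inner_norm_le bXi _ _) _.
  apply: (@le_trans _ _ (`|Mj| * rnorm v * (`|Mj| * rnorm w))).
    by rewrite ler_pM ?rnorm_ge0.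
  by rewrite le_eqVlt; apply/orP; left; apply/eqP; ring.
have F1_quad : convex_quadratic F1.
  exists (fun v w => bX (j v) (j w)), (fun v => - 2 * bX (j v) f), (rnorm f ^+ 2),
    (`|Mj| ^+ 2 + 2 * `|Mj| * rnorm f); split.
  - split; first split=> [y t v w|v t w y]; rewrite ?linearP/= ?(rbE bXb)//.
    by move=> t v w; rewrite linearP/= !(rbE bXb); ring.
  - by move=> v; rewrite (real_innerxx bXi) sqr_ge0.
  - move=> v w; apply: le_trans (jj_bd v w) _.
    apply: ler_wpM2r; first exact: rnorm_ge0.
    apply: ler_wpM2r; first exact: rnorm_ge0.
    by rewrite lerDl !mulr_ge0 ?rnorm_ge0.
  - move=> v; rewrite normrM normrN normr_nat.
    have := real_inner_norm_le bXi (j v) f.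
    have : rnorm (j v) * rnorm f <= `|Mj| * rnorm v * rnorm f.
      by rewrite ler_wpM2r ?rnorm_ge0.
    have : 0 <= `|Mj| ^+ 2 * rnorm v by rewrite mulr_ge0 ?sqr_ge0 ?rnorm_ge0.
    lra.
  - by move=> v; rewrite /F1 (rnormB_sqr bXi) (real_innerxx bXi); ring.
have F2_quad : convex_quadratic F2.
  exists B, (fun v => - al v u), 0,
    (`|M| + omega * `|Mj| ^+ 2 + `|M| * rnorm u); split.
  - by split=> // t v w; rewrite !(rbE al_bil); ring.
  - by move=> v; rewrite /B (real_innerxx bXi); have := al_ge v; lra.
  - move=> v w; apply: le_trans (ler_normD _ _) _.
    rewrite normrM (ger0_norm omega0).
    have := M_ge0 v w.
    have : omega * `|bX (j v) (j w)| <= omega * (`|Mj| ^+ 2 * rnorm v * rnorm w).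
      by rewrite ler_wpM2l// jj_bd.
    have : 0 <= `|M| * rnorm u * (rnorm v * rnorm w) by rewrite !mulr_ge0 ?rnorm_ge0.
    lra.
  - move=> v; rewrite normrN; have := M_ge0 v u.
    have : 0 <= (`|M| + omega * `|Mj| ^+ 2) * rnorm v.
      by rewrite mulr_ge0 ?rnorm_ge0// addr_ge0// mulr_ge0// sqr_ge0.
    lra.
  - by move=> v; rewrite addr0.
pose c2 n := omega * rnorm f ^+ 2 + n.+1%:R^-1.
have res_arith (x y r s m q : R) : x - y <= 0 ->
    omega * r ^+ 2 <= omega * (s + m) ^+ 2 -> omega * (m * m) <= omega * m ->
    m * (omega * (2 * s + 1) + 1) <= q -> 0 < m ->
    x + omega * r ^+ 2 - y <= omega * s ^+ 2 + q by lra.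
have F_in n : exists2 v, F1 v <= n.+1%:R^-1 & F2 v <= c2 n.
  have n0 : 0 < n.+1%:R^-1 :> R by rewrite invr_gt0.
  have K0 : 0 <= omega * (2 * rnorm f + 1).
    by rewrite mulr_ge0// addr_ge0// mulr_ge0// rnorm_ge0.
  have K10 : 0 < omega * (2 * rnorm f + 1) + 1 by rewrite ltr_wpDl.
  (* If [j v] is within [m] of [f], the shift exceeds [omega * rnorm f ^+ 2] by at most
     [omega * m * (2 * rnorm f + 1)]; the extra [+ 1] in the denominator also yields
     [m <= n.+1%:R^-1], as needed for [F1]. *)
  pose m := Order.min 1 (n.+1%:R^-1 / (omega * (2 * rnorm f + 1) + 1)).
  have m0 : 0 < m by rewrite lt_min ltr01 divr_gt0.
  have m1 : m <= 1 by rewrite ge_min lexx.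
  have mn : m * (omega * (2 * rnorm f + 1) + 1) <= n.+1%:R^-1.
    by rewrite -ler_pdivlMr// ge_min lexx orbT.
  have [L LP] := resolvent_cvg f m0.
  pose lam := Order.max L (2 * omega + 1).
  have lamL : L <= lam by rewrite le_max lexx.
  have lamo : 2 * omega + 1 <= lam by rewrite le_max lexx orbT.
  have o0 := omega0.
  have [|v vf] := @resolvent_ex lam f; first by lra.
  have vm := LP _ _ lamL vf.
  have F2v := @res_le lam v; exists v; first last.
    have {F2v}F2v : al v v - al v u <= 0 by apply: F2v => //; lra.
    have jv : rnorm (j v) <= rnorm f + m.
      by have := rnorm_sub_norm (j v) f; lra.
    have : rnorm (j v) ^+ 2 <= (rnorm f + m) ^+ 2.
      by rewrite lerXn2r ?nnegrE ?rnorm_ge0// addr_ge0 ?rnorm_ge0// ltW.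
    have f0 := rnorm_ge0 f; rewrite /F2 /B /c2 (real_innerxx bXi) => jv2.
    have jv3 : omega * rnorm (j v) ^+ 2 <= omega * (rnorm f + m) ^+ 2.
      by rewrite ler_wpM2l.
    have mm : omega * (m * m) <= omega * m by rewrite ler_wpM2l// ler_piMl// ltW.
    exact: res_arith F2v jv3 mm mn m0.
  have mq : m <= n.+1%:R^-1.
    by apply: le_trans mn; rewrite mulrDr mulr1 lerDr mulr_ge0// ltW.
  apply: le_trans mq; apply: (@le_trans _ _ (m ^+ 2)).
    by rewrite lerXn2r ?nnegrE ?rnorm_ge0 ?(ltW m0)// ltW.
  by rewrite expr2 ler_piMl// ltW.
have [|||||v vP] := @nested_convex _ V bV bVi
  (fun n => [set v | F1 v <= n.+1%:R^-1 /\ F2 v <= c2 n])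
  (1 + (`|M| * rnorm u + `|c2 0%N|) / kappa).
- by move=> n; have [v v1 v2] := F_in n; exists v.
- move=> n v /= [v1 v2].
  have nn : n.+2%:R^-1 <= n.+1%:R^-1 :> R by rewrite lef_pV2 ?posrE// ler_nat.
  by split; [exact: le_trans nn|apply: (le_trans v2); rewrite lerD2l].
- move=> n x y /= [x1 x2] [y1 y2].
  by split; exact: convex_quadratic_mid.
- move=> n v h; split; apply: convex_quadratic_closed => // e e0.
    by have [w [w1 w2] vw] := h e e0; exists w.
  by have [w [w1 w2] vw] := h e e0; exists w.
(* As in the minimization above: either [rnorm v <= 1], or the quadratic inequality is divided by
   [rnorm v]. *)
- move=> v [_]; move: (c2 0%N) => c; rewrite /F2 /B (real_innerxx bXi) => v2.
  have [v1|v1] := leP (rnorm v) 1.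
    rewrite (le_trans v1)// lerDl divr_ge0 ?(ltW kappa0)//.
    by rewrite addr_ge0// mulr_ge0// rnorm_ge0.
  rewrite -lerBlDl ler_pdivlMr//.
  have H1 := al_ell v; have H2 := le_trans (ler_norm _) (M_ge0 v u).
  have H3 := ler_norm c; have H4 := normr_ge0 c.
  have h3 : (kappa * rnorm v - `|M| * rnorm u) * rnorm v <= `|c| * rnorm v.
    apply: (@le_trans _ _ `|c|); last by rewrite ler_peMr// ltW.
    lra.
  rewrite ler_pM2r in h3; last exact: lt_trans v1.
  by have := kappa0; lra.
have jvf : j v = f.
  apply/eqP; rewrite -subr_eq0; apply/eqP/rnorm0_eq0/eqP.
  rewrite -sqrf_eq0 eq_le sqr_ge0 andbT; apply: ler_add_invS => n.
  by rewrite add0r; case: (vP n).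
exists v => //.
have : F2 v <= omega * rnorm f ^+ 2.
  by apply: ler_add_invS => n; case: (vP n).
by rewrite /F2 /B (real_innerxx bXi) jvf (rbBr al_bil); lra.
Qed.

Hypothesis formP : forall u, exists2 v, j v = P (j u) & 0 <= al v (u - v).

(** [al u (u - v)] is the sum of [al v (u - v)] and [al (u - v) (u - v)]. This moves the condition
    from the projected point to [u], where the resolvent and generator equations hold. *)
Let form_proj_ge u v : j v = P (j u) -> 0 <= al v (u - v) ->
  - (omega * rnorm (j u - P (j u)) ^+ 2) <= al u (u - v).
Proof.
move=> jv uv; rewrite -jv -linearB; apply: le_trans (al_ge (u - v)) _.
by rewrite [leLHS](rbBl al_bil) gerBl.
Qed.

(** Test the resolvent equation with [u - v], where [j v = P (j u)]: the obtuse angle at [P (j u)]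
    and [form_proj_ge] give [(lam - omega) * rnorm (j u - P (j u)) ^+ 2 <= 0]. *)
Lemma form_resolvent_invariant lam f u : omega < lam -> C f ->
  resolvent_at lam f u -> C (j u).
Proof.
move=> ol Cf uf; apply: projection_id.
have [v jv uv] := formP u.
have := form_proj_ge jv uv; rewrite uf linearB/= jv.
have := projection_obtuse (j u) Cf.
rewrite -[f - j u]opprB.
have -> : j u - f = (j u - P (j u)) - (f - P (j u)).
  by rewrite opprB addrA subrK.
move: (j u - P (j u)) (f - P (j u)) => x y xy.
rewrite (rbNl bXb) (rbBl bXb) (real_innerxx bXi) (real_innerC bXi y) => H.
have x2 : (lam - omega) * rnorm x ^+ 2 <= 0.
  have o0 := omega0.
  have : lam * bX x y <= 0 by rewrite pmulr_rle0//; lra.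
  lra.
move: x2; rewrite pmulr_rle0 ?subr_gt0// => x2.
by have /eqP : rnorm x ^+ 2 = 0 by [apply/eqP; rewrite eq_le x2 sqr_ge0];
  rewrite sqrf_eq0 => /eqP ->.
Qed.

Lemma form_invariant t x : 0 < t -> C x -> C (S t x).
Proof.
(* Reduction to the domain: the resolvents of [x] stay in [C] and approximate [x], so [S t x] has
   distance 0 to [C]. *)
suff H : forall (t : R) x y, 0 < t -> derivative_at0 x y -> C x -> C (S t x).
  move=> t0 Cx; apply: projection_id; apply/ler_addgt0Pr => e e0; rewrite add0r.
  have E0 := expR_gt0 (omega * t).
  have [L LP] := resolvent_cvg x (divr_gt0 e0 E0).
  pose lam := Order.max L (omega + 1).
  have lamL : L <= lam by rewrite le_max lexx.
  have lamo : omega + 1 <= lam by rewrite le_max lexx orbT.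
  have [|u ux] := @resolvent_ex lam x; first by lra.
  have := LP _ _ lamL ux; rewrite ltr_pdivlMr// => xu.
  have Cu : C (j u) by apply: form_resolvent_invariant ux => //; lra.
  apply: le_trans (P_le _ (H _ _ _ t0 (resolvent_at_der ux) Cu)) _.
  rewrite -S_B//; apply: le_trans (quasi_contraction _ t0) _.
  by rewrite rnormB mulrC ltW.
move=> {}t {}x y t0 xy Cx.
pose phi t := rnorm (orbit t x - P (orbit t x)) ^+ 2.
have : phi t <= expR (2 * omega * t) * phi 0.
  apply: (@dini_gronwall _ phi (t + 1) (2 * omega)) => //.
  - by rewrite mulr_ge0.
  - by move=> s; exact: sqr_ge0.
  - move=> s s0 _ e e0.
    have := orbit_dini (P (orbit s x)) s0 e0 xy.
    rewrite !near_right0P => -[c c0 cP]; exists c => // h h0 hc.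
    (* The projection is frozen at time [s]: [P (orbit s x)] is a competitor for the distance at
       time [s + h], and [orbit_dini] applies with this fixed centre. *)
    rewrite /phi; apply: (@le_trans _ _ (rnorm (orbit (s + h) x - P (orbit s x)) ^+ 2)).
      by rewrite lerXn2r ?nnegrE ?rnorm_ge0// P_le.
    apply: le_trans (cP h h0 hc) _.
    rewrite lerD2l ler_pM2l// lerD2r -mulrA ler_pM2l//.
    have /S_gen[u ju uP] := orbit_der s0 xy.
    have [v jv uv] := formP u.
    have := form_proj_ge jv uv; rewrite uP linearB/= jv ju; lra.
  - move=> s s0 _ e e0.
    have [c c0 cP] := ler_sqr_eps (rnorm_ge0 (orbit s x - P (orbit s x))) e0.
    have := S_left_cvg x s0 c0.
    rewrite !near_right0P => -[d d0 dP]; exists (Order.min d s); first by rewrite lt_min d0.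
    move=> h h0; rewrite lt_min => /andP[hd hs].
    have sh0 : 0 < s - h by rewrite subr_gt0.
    apply: cP; first exact: rnorm_ge0.
    apply: le_trans (P_le _ (P_in (orbit (s - h) x))) _.
    apply: le_trans (ler_rnorm_distD _ (orbit (s - h) x) _) _.
    by rewrite addrC lerD2l /orbit s0 sh0; exact: dP.
  - exact: ltW.
  - by rewrite ltrDl.
have -> : phi 0 = 0.
  rewrite /phi orbit0; apply/eqP; rewrite sqrf_eq0 eq_le rnorm_ge0 andbT.
  by apply: le_trans (P_le x Cx) _; rewrite subrr rnorm0.
rewrite mulr0 /phi /orbit t0 => phit; apply: projection_id.
have : rnorm (S t x - P (S t x)) ^+ 2 == 0 by rewrite eq_le phit sqr_ge0.
by rewrite sqrf_eq0 => /eqP ->.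
Qed.

End invariance.

End form_semigroup.

(** * The inner product of L2 *)

Section sesquilinear_real_part.
Context (R : realType).

Lemma sesquilinear_rbilinear (V : normedModType R[i]) (a : {sesquilinear V}) :
  rbilinear (fun u v => complex.Re (a u v)).
Proof.
split=> [y t u v|u t x y].
  by rewrite linearPl/= raddfD/=; case: (a u y) => ? ? /=; rewrite mul0r subr0.
by rewrite linearPr/= raddfD/=; case: (a u x) => ? ? /=; rewrite oppr0 mul0r subr0.
Qed.

(** The form is conjugate linear in its second argument. Real parts at all vectors thus determine
    the form, which justifies working with real parts alone. *)
Lemma sesquilinear_im (V : normedModType R[i]) (a : {sesquilinear V}) u v :
  complex.Im (a u v) = complex.Re (a u ('i *: v)).
Proof.
rewrite linearZr_LR /=; case: (a u v) => x y /=.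
by rewrite mul0r sub0r mulN1r opprK.
Qed.

Context (H : hilbertType R).

Lemma hilbert_real_inner : real_inner (fun x y : H => complex.Re (inner x y)).
Proof.
split; first exact: sesquilinear_rbilinear.
- move=> x y; rewrite hermC /= expr0 mul1r.
  by case: (inner y x).
- move=> x; rewrite -normr_inner -rnormE -rmorphXn//.
Qed.

End sesquilinear_real_part.

Section real_integrals.
Context d (T : measurableType d) (R : realType) (mu : {measure set T -> \bar R}).
Implicit Types f g : T -> R.

Definition rintegrable f := mu.-integrable setT (EFin \o f).

Lemma rintegrableD f g : rintegrable f -> rintegrable g -> rintegrable (f \+ g).
Proof. by move=> fi gi; exact: (integrableD measurableT fi gi). Qed.

Lemma rintegrableZ (k : R) f : rintegrable f -> rintegrable (fun x => k * f x).
Proof. by move=> fi; exact: (integrableZl measurableT k fi). Qed.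

Lemma rintegrable_le f g : measurable_fun setT f ->
  (forall x, `|f x| <= g x) -> rintegrable g -> rintegrable f.
Proof.
move=> mf fg; apply: le_integrable => //; first exact/measurable_EFinP.
by move=> x _; rewrite lee_fin (le_trans (fg x))// ler_norm.
Qed.

Lemma rintegrable_measurable f : rintegrable f -> measurable_fun setT f.
Proof. by move=> /integrableP[/measurable_EFinP]. Qed.

Lemma rintegrable_ae f g : measurable_fun setT f -> f = g %[ae mu] ->
  rintegrable g -> rintegrable f.
Proof.
move=> mf fg gi; have mg := rintegrable_measurable gi.
move: gi => /integrableP[_]; rewrite /rintegrable => gi.
apply/integrableP; split; first exact/measurable_EFinP.
apply: le_lt_trans gi; rewrite le_eqVlt; apply/orP; left; apply/eqP.
apply: ge0_ae_eq_integral => //; try by apply: measurableT_comp => //; exact/measurable_EFinP.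
by apply: filterS fg => x /(_ I) /= -> _.
Qed.

Lemma ae_eq_Rintegral f g : measurable_fun setT f -> measurable_fun setT g ->
  f = g %[ae mu] -> \int[mu]_x f x = \int[mu]_x g x.
Proof.
move=> mf mg fg; congr fine; apply: ae_eq_integral => //; try exact/measurable_EFinP.
by apply: filterS fg => x /(_ I) /= -> _.
Qed.

Lemma Rintegral_ge0_eq0 f : rintegrable f -> (forall x, 0 <= f x) ->
  \int[mu]_x f x <= 0 -> f = cst 0 %[ae mu].
Proof.
move=> fi f0 If; have mf := rintegrable_measurable fi.
have /measurable_EFinP mf' := mf.
have : (\int[mu]_x `|(EFin \o f) x|)%E = 0%E.
  under eq_integral do rewrite /= ger0_norm//.
  have fin : (\int[mu]_x (f x)%:E)%E \is a fin_num by exact: integrable_fin_num.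
  rewrite -(fineK fin); congr (_%:E); apply/eqP; rewrite eq_le If/=.
  by apply: fine_ge0; apply: integral_ge0 => x _; rewrite lee_fin.
move=> /(ae_eq_integral_abs mu measurableT mf').
by apply: filterS => x /(_ I) + _; rewrite /= => -[].
Qed.

End real_integrals.

Section bochner_integrals.
Context d (T : measurableType d) (R : realType) (mu : {measure set T -> \bar R}).
Context (H : normedModType R[i]).
Implicit Types u v : T -> H.

Lemma measurable_rnorm_powR (p : R) u : strongly_measurable u ->
  measurable_fun setT (fun x => rnorm (u x) `^ p).
Proof.
move=> su; apply: (@measurableT_comp _ _ _ _ _ _ (fun x : R => x `^ p)) => //.
exact: measurable_normf.
Qed.

Lemma bochner_normE (p : R) u : bochner_norm mu p u =
  ((\int[mu]_x (rnorm (u x) `^ p)%:E) `^ p^-1)%E.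
Proof.
rewrite /bochner_norm unlock /=.
by under eq_integral => x _ do rewrite /normf ger0_norm ?rnorm_ge0//.
Qed.

Lemma bochner_norm_fin (p : R) u : 0 < p -> strongly_measurable u ->
  (bochner_norm mu p u < +oo)%E <-> rintegrable mu (fun x => rnorm (u x) `^ p).
Proof.
move=> p0 su; rewrite bochner_normE.
have mu_ := measurable_rnorm_powR p su.
have I0 : (0 <= \int[mu]_x (rnorm (u x) `^ p)%:E)%E.
  by apply: integral_ge0 => x _; rewrite lee_fin powR_ge0.
split=> [If|/integrableP[_]].
  apply/integrableP; split; first exact/measurable_EFinP.
  under eq_integral do rewrite /= ger0_norm ?powR_ge0//.
  rewrite ltNge; apply/negP; rewrite leye_eq => /eqP Iy; move: If.
  by rewrite Iy poweRyr// gt_eqF// invr_gt0.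
under eq_integral do rewrite /= ger0_norm ?powR_ge0//.
by move=> If; apply: poweR_lty.
Qed.

Lemma bochner_norm_Rintegral (p : R) u : 0 < p -> strongly_measurable u ->
  rintegrable mu (fun x => rnorm (u x) `^ p) ->
  bochner_norm mu p u = ((\int[mu]_x (rnorm (u x) `^ p)) `^ p^-1)%:E.
Proof.
move=> p0 su ui; rewrite bochner_normE -poweR_EFin /Rintegral fineK//.
exact: integrable_fin_num.
Qed.

Lemma bochner_norm_le1 (p : R) u : 0 < p -> strongly_measurable u ->
  rintegrable mu (fun x => rnorm (u x) `^ p) ->
  (bochner_norm mu p u <= 1)%E = (\int[mu]_x (rnorm (u x) `^ p) <= 1).
Proof.
move=> p0 su ui; rewrite bochner_norm_Rintegral// lee_fin.
have I0 : 0 <= \int[mu]_x (rnorm (u x) `^ p).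
  by apply: Rintegral_ge0 => x _; exact: powR_ge0.
have p'0 : 0 <= p^-1 by rewrite invr_ge0 ltW.
apply/idP/idP => h.
  have := ge0_ler_powR (ltW p0) (powR_ge0 _ _) ler01 h.
  by rewrite -powRrM mulVf ?gt_eqF// powRr1// powR1.
by have := ge0_ler_powR p'0 I0 ler01 h; rewrite powR1.
Qed.

End bochner_integrals.

Section L2_inner_product.
Context d (T : measurableType d) (R : realType) (mu : {measure set T -> \bar R}).
Context (H : hilbertType R).
Implicit Types (f g : L2 mu H) (u v : T -> H).

Let hi := @hilbert_real_inner R H.
Let hb := real_inner_bil hi.

Lemma strongly_measurableD u v : strongly_measurable u -> strongly_measurable v ->
  strongly_measurable (u + v).
Proof. by move=> su sv; rewrite -[u]scale1r; exact: strongly_measurableP. Qed.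

(** Polarization expresses the real inner product through three norms. *)
Lemma measurable_inner u v : strongly_measurable u -> strongly_measurable v ->
  measurable_fun setT (fun x => complex.Re (inner (u x) (v x))).
Proof.
move=> su sv.
have -> : (fun x => complex.Re (inner (u x) (v x))) =
    (fun x => 2^-1 * (normf (u + v) x ^+ 2 - normf u x ^+ 2 - normf v x ^+ 2)).
  by apply/funext => x; rewrite /normf [(u + v) x]/(u x + v x) (rnormD_sqr hi); field.
apply: measurable_funM => //; apply: measurable_funB; first apply: measurable_funB.
- by apply: measurable_funX; apply: measurable_normf; exact: strongly_measurableD.
- by apply: measurable_funX; exact: measurable_normf.
- by apply: measurable_funX; exact: measurable_normf.
Qed.

Lemma L2_strongly_measurable f : strongly_measurable (f : T -> H).
Proof. by case: (bochner_reprP f). Qed.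

Lemma L2_rintegrable f : rintegrable mu (fun x => rnorm (f x) ^+ 2).
Proof.
have [sf ff] := bochner_reprP f.
have := (bochner_norm_fin mu (ltr0n _ 2) sf).1 ff.
by apply: eq_integrable => // x _ /=; rewrite powR_mulrn ?rnorm_ge0.
Qed.

Lemma real_inner_le_half (x y : H) :
  `|complex.Re (inner x y)| <= rnorm x ^+ 2 / 2 + rnorm y ^+ 2 / 2.
Proof.
apply: le_trans (real_inner_norm_le hi x y) _.
by have := sqr_ge0 (rnorm x - rnorm y); rewrite sqrrB; lra.
Qed.

Lemma rintegrable_inner f g :
  rintegrable mu (fun x => complex.Re (inner (f x) (g x))).
Proof.
apply: rintegrable_le (rintegrableD (rintegrableZ 2^-1 (L2_rintegrable f))
  (rintegrableZ 2^-1 (L2_rintegrable g))).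
  by apply: measurable_inner; exact: L2_strongly_measurable.
by move=> x /=; apply: le_trans (real_inner_le_half _ _) _; rewrite ![2^-1 * _]mulrC.
Qed.

Definition L2_rinner f g := complex.Re (L2_inner f g).

Lemma L2_rinnerE f g :
  L2_rinner f g = \int[mu]_x complex.Re (inner (f x) (g x)).
Proof. by []. Qed.

Lemma L2_rinner_ae f g u v : strongly_measurable u -> strongly_measurable v ->
  bochner_repr f = u %[ae mu] -> bochner_repr g = v %[ae mu] ->
  L2_rinner f g = \int[mu]_x complex.Re (inner (u x) (v x)).
Proof.
move=> su sv fu gv; apply: ae_eq_Rintegral.
- by apply: measurable_inner; exact: L2_strongly_measurable.
- exact: measurable_inner.
- by apply: filterS2 fu gv => x /(_ I) -> /(_ I) ->.
Qed.

Lemma L2_rnorm_sqr f : rnorm f ^+ 2 = \int[mu]_x (rnorm (f x) ^+ 2).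
Proof.
have [sf ff] := bochner_reprP f.
have fi := (bochner_norm_fin mu (ltr0n _ 2) sf).1 ff.
rewrite /rnorm/= /bochner_normr/= bochner_norm_Rintegral//= -powR_mulrn ?powR_ge0//.
rewrite -powRrM mulVf// powRr1; last by apply: Rintegral_ge0 => x _; exact: powR_ge0.
by apply: eq_Rintegral => x _; rewrite powR_mulrn ?rnorm_ge0.
Qed.

Lemma L2_real_inner : real_inner L2_rinner.
Proof.
have L2_rinnerC f g : L2_rinner f g = L2_rinner g f.
  by apply: eq_Rintegral => x _; exact: (real_innerC hi).
have L2_rinnerl g : rlinear (L2_rinner^~ g).
  move=> t f h.
  have sf := L2_strongly_measurable f; have sg := L2_strongly_measurable g.
  have sh := L2_strongly_measurable h.
  rewrite (@L2_rinner_ae _ _ (t%:C *: bochner_repr f + bochner_repr h) (bochner_repr g))//.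
  - have fi := rintegrable_inner f g; have hgi := rintegrable_inner h g.
    rewrite !L2_rinnerE -(RintegralZl t measurableT fi).
    rewrite -(RintegralD measurableT (rintegrableZ t fi) hgi).
    apply: eq_Rintegral => x _; 
    by have <- := hb.1 (bochner_repr g x) t (bochner_repr f x) (bochner_repr h x).
  - exact: strongly_measurableP.
  - have := bochner_reprD (t%:C *: f) h; have := bochner_reprZ t%:C f.
    by apply: filterS2 => x /(_ I) fx /(_ I) fhx _; rewrite fhx /GRing.add/= fx.
  - exact: nearW.
split=> //.
- by split=> // f t g h; rewrite ![L2_rinner f _]L2_rinnerC L2_rinnerl.
- move=> f; rewrite L2_rnorm_sqr; apply: eq_Rintegral => x _.
  exact: (real_innerxx hi).
Qed.

Lemma L2_inner_im f g : complex.Im (L2_inner f g) = L2_rinner f ('i *: g).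
Proof.
have [sf sg] := (L2_strongly_measurable f, L2_strongly_measurable g).
rewrite (@L2_rinner_ae _ _ (bochner_repr f) ('i *: bochner_repr g))//.
- by apply: eq_Rintegral => x _; rewrite sesquilinear_im.
- by rewrite -[_ *: _]addr0; apply: strongly_measurableP => //; exact: strongly_measurable0.
- exact: nearW.
- exact: bochner_reprZ.
Qed.

End L2_inner_product.

(** * Duality and the projection onto the Lp ball *)

Section young_equality.
Context (R : realType) (p q : R).
Hypotheses (p0 : 0 < p) (q0 : 0 < q) (pq : p^-1 + q^-1 = 1).

Lemma conjugate_exponentD : p + q = p * q.
Proof.
have -> : p + q = p * q * (p^-1 + q^-1) by field; rewrite !gt_eqF.
by rewrite pq mulr1.
Qed.

Lemma conjugate_exponentM : (p - 1) * q = p.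
Proof. by rewrite mulrBl mul1r -conjugate_exponentD addrK. Qed.

Lemma conjugate_exponent_gt1 : 1 < p.
Proof. by rewrite -subr_gt0 -(pmulr_lgt0 _ q0) conjugate_exponentM. Qed.

(** For positive [a] and [b] write [a^p = a b e^X] and [b^q = a b e^Y]; conjugacy gives
    [X / p + Y / q = 0]. The strict bound [1 + X < e^X] for [X != 0] contradicts the hypothesis, and
    [X = 0] is the claim. *)
Lemma young_eq (a b : R) : 0 <= a -> 0 <= b ->
  a `^ p / p + b `^ q / q <= a * b -> b = a `^ (p - 1).
Proof.
have p1 : 0 < p - 1 by rewrite subr_gt0 conjugate_exponent_gt1.
have pow_le0 (x s : R) : 0 <= x -> 0 < s -> x `^ s / s <= 0 -> x = 0.
  move=> x0 s0; rewrite pmulr_lle0 ?invr_gt0// => xs.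
  by apply: (@powR_eq0_eq0 _ _ s); apply/eqP; rewrite eq_le xs powR_ge0.
rewrite le_eqVlt => /predU1P[<- b0|a0].
  rewrite !powR0 ?gt_eqF// mul0r mul0r add0r; exact: pow_le0.
rewrite le_eqVlt => /predU1P[<-|b0].
  rewrite mulr0 powR0 ?gt_eqF// mul0r addr0 => /(pow_le0 _ _ (ltW a0) p0) a00.
  by rewrite a00 ltxx in a0.
pose A := ln a; pose B := ln b; pose X := (p - 1) * A - B; pose Y := (q - 1) * B - A.
have aE : a = expR A by rewrite lnK.
have bE : b = expR B by rewrite lnK.
have abX : a `^ p = a * b * expR X.
  by rewrite /powR gt_eqF// aE bE -!expRD; congr expR; rewrite -aE /X -/A; ring.
have abY : b `^ q = a * b * expR Y.
  by rewrite /powR gt_eqF// aE bE -!expRD; congr expR; rewrite -bE /Y -/B; ring.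
have XY : X / p + Y / q = 0.
  have -> : X / p + Y / q = ((p * q - (p + q)) * A + (p * q - (p + q)) * B) / (p * q).
    by rewrite /X /Y; field; rewrite !gt_eqF.
  by rewrite conjugate_exponentD subrr !mul0r addr0 mul0r.
have ab0 : 0 < a * b by rewrite mulr_gt0.
rewrite abX abY => H.
have {}H : expR X / p + expR Y / q <= 1.
  by rewrite -(ler_pM2l ab0) mulr1 mulrDr !mulrA.
have [X0|X0] := eqVneq X 0.
  rewrite /powR gt_eqF// bE; congr expR; rewrite -/A.
  by move/eqP: X0; rewrite subr_eq0 => /eqP.
have HX : (1 + X) / p < expR X / p by rewrite ltr_pM2r ?invr_gt0// expR_gt1Dx.
have HY : (1 + Y) / q <= expR Y / q by rewrite ler_pM2r ?invr_gt0// expR_ge1Dx.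
by move: pq XY; lra.
Qed.

End young_equality.

Section duality_map.
Context (R : realType) (H : hilbertType R) (p q : R).
Hypotheses (p0 : 0 < p) (q0 : 0 < q) (pq : p^-1 + q^-1 = 1).
Implicit Types x y g u : H.

Local Notation ip x y := (complex.Re (inner x y)).
Let hi := @hilbert_real_inner R H.
Let hb := real_inner_bil hi.
Let p1 : 0 < p - 1. Proof. by rewrite subr_gt0 (conjugate_exponent_gt1 p0 q0 pq). Qed.

(* This is [|y|^(p-1) sgn y]; at [y = 0] the factor is the junk value [0 / 0 = 0]. *)
Definition duality_map y : H := (rnorm y `^ (p - 1) / rnorm y)%:C *: y.

Lemma normf_pow_sgnfE (T : Type) (f : T -> H) (x : T) :
  normf_pow_sgnf p f x = duality_map (f x).
Proof.
rewrite /normf_pow_sgnf /sgnf /duality_map; case: eqVneq => [->|fx0].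
  by rewrite !scaler0.
by rewrite scalerA -rnormE -fmorphV -rmorphM.
Qed.

Lemma rnorm_eq0 y : (rnorm y == 0) = (y == 0).
Proof. by apply/eqP/eqP => [/rnorm0_eq0//|->]; rewrite rnorm0. Qed.

Lemma rnorm_gt0 y : (0 < rnorm y) = (y != 0).
Proof. by rewrite lt_neqAle rnorm_ge0 andbT eq_sym rnorm_eq0. Qed.

Lemma rnorm_duality_map y : rnorm (duality_map y) = rnorm y `^ (p - 1).
Proof.
rewrite rnormZr ger0_norm ?divr_ge0 ?powR_ge0 ?rnorm_ge0//.
have [->|y0] := eqVneq y 0; first by rewrite rnorm0 mulr0 powR0// gt_eqF.
by rewrite divfK// rnorm_eq0.
Qed.

Lemma rnorm_duality_map_powR y : rnorm (duality_map y) `^ q = rnorm y `^ p.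
Proof. by rewrite rnorm_duality_map -powRrM (conjugate_exponentM p0 q0 pq). Qed.

Lemma inner_duality_map y : ip (duality_map y) y = rnorm y `^ p.
Proof.
rewrite (rbZl hb) (real_innerxx hi).
have [->|y0] := eqVneq y 0; first by rewrite rnorm0 expr0n/= mulr0 powR0// gt_eqF.
by rewrite expr2 mulrA divfK ?rnorm_eq0// mulrC mulr_powRB1 ?rnorm_ge0.
Qed.

Lemma duality_mapZ (c : R) y : 0 < c ->
  duality_map (c%:C *: y) = (c `^ (p - 1))%:C *: duality_map y.
Proof.
move=> c0; rewrite /duality_map rnormZr gtr0_norm// powRM ?rnorm_ge0 ?(ltW c0)//.
rewrite !scalerA -!rmorphM; congr (_%:C *: _).
have [->|y0] := eqVneq (rnorm y) 0; first by rewrite mulr0 invr0 !mulr0 mul0r.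
by field; rewrite y0 gt_eqF.
Qed.

Lemma inner_young x y : ip x y <= rnorm y `^ p / p + rnorm x `^ q / q.
Proof.
apply: le_trans (real_inner_le hi x y) _; rewrite mulrC.
by apply: conjugate_powR; rewrite ?rnorm_ge0.
Qed.

(** The hypothesis forces equality both in the scalar Young inequality, which fixes [rnorm x], and
    in Cauchy-Schwarz, which fixes the direction of [x]. *)
Lemma inner_young_eq x y : rnorm y `^ p / p + rnorm x `^ q / q <= ip x y ->
  x = duality_map y.
Proof.
move=> h; have xy := real_inner_le hi x y.
have E : rnorm x = rnorm y `^ (p - 1).
  apply: (young_eq p0 q0 pq); rewrite ?rnorm_ge0//.
  by rewrite [leRHS]mulrC; apply: le_trans xy.
have xyE : rnorm x * rnorm y <= ip x y.
  apply: le_trans h; rewrite mulrC.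
  by apply: conjugate_powR; rewrite ?rnorm_ge0.
have [y0|y0] := eqVneq y 0.
  have -> : x = 0 by apply: rnorm0_eq0; rewrite E y0 rnorm0 powR0// gt_eqF.
  by rewrite y0 /duality_map scaler0.
apply/eqP; rewrite -subr_eq0 -rnorm_eq0 -sqrf_eq0 eq_le sqr_ge0 andbT.
rewrite (rnormB_sqr hi) rnorm_duality_map -E (rbZr hb) -E.
have yn0 : 0 < rnorm y by rewrite rnorm_gt0.
have : rnorm x / rnorm y * (rnorm x * rnorm y) <= rnorm x / rnorm y * ip x y.
  by rewrite ler_wpM2l// divr_ge0 ?rnorm_ge0.
have -> : rnorm x / rnorm y * (rnorm x * rnorm y) = rnorm x ^+ 2.
  by field; rewrite gt_eqF.
lra.
Qed.

End duality_map.

Section strong_measurability.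
Import HBSimple.
Context d (T : measurableType d) (R : realType) (H : normedModType R[i]).

Lemma fimfun_preimage_measurable (Y : Type) (s : {fimfun T >-> Y}) (A : set Y) :
  (forall y, measurable (s @^-1` [set y])) -> measurable (s @^-1` A).
Proof.
move=> ms; have -> : s @^-1` A = \bigcup_(y in range s `&` A) s @^-1` [set y].
  apply/seteqP; split => [x /= Ax|x [y [_ Ay] /= ->//]].
  by exists (s x) => //; split => //; exists x.
by apply: fin_bigcup_measurable => //; apply: finite_setIl; exact: fimfunP.
Qed.

Lemma rnorm_cvg0 (w : nat -> H) (v : H) :
  (fun n => rnorm (v - w n)) @ \oo --> 0 -> w @ \oo --> v.
Proof.
move=> wv; apply/cvgrPdist_lt => e e0.
have re0 : 0 < complex.Re e by move: e0; rewrite ltcE/= => /andP[].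
have /cvgrPdist_lt/(_ _ re0) := wv; apply: filterS => n.
rewrite sub0r normrN ger0_norm ?rnorm_ge0// => vw.
by rewrite -rnormE -[e]RRe_real ?ltcR// realE ltW.
Qed.

(** Products of simple approximations of [phi] and [u] converge pointwise; a level set of such a
    product splits over the finitely many values of the second factor. *)
Lemma strongly_measurableZ (phi : T -> R) (u : T -> H) :
  measurable_fun setT phi -> strongly_measurable u ->
  strongly_measurable (fun x => (phi x)%:C *: u x).
Proof.
move=> mphi [s [ms su]].
have /measurable_EFinP mphi' := mphi.
have [g gphi] := approximation_sfun measurableT mphi'.
have fgs n : finite_set (range (fun x => (g n x)%:C *: s n x)).
  have := finite_image2 (fun (y : R) (z : H) => y%:C *: z)
    (@fimfunP _ _ (g n)) (@fimfunP _ _ (s n)).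
  apply: sub_finite_set => _ [x _ <-] /=.
  by exists (g n x); [exists x|exists (s n x) => //; exists x].
pose w n : {fimfun T >-> H} :=
  FImFun.Pack (FImFun.Class (FiniteImage.Build _ _ _ (fgs n))).
exists w; split=> [n y|x]; last first.
  have gx : (fun n => g n x) @ \oo --> phi x.
    by have /fine_cvgP[_] := gphi x I.
  have ux : (fun n => rnorm (u x - s n x)) @ \oo --> 0.
    rewrite -(rnorm0 H) -(subrr (u x)); apply: cvg_rnorm.
    by apply: cvgB; [exact: cvg_cst|exact: su].
  apply: rnorm_cvg0.
  apply: (@squeeze_cvgr _ _ _ _ (fun=> 0)
    (fun n => `|phi x - g n x| * rnorm (u x) + `|g n x| * rnorm (u x - s n x))).
  - apply: nearW => n; rewrite rnorm_ge0/=.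
    have -> : (phi x)%:C *: u x - (g n x)%:C *: s n x =
        (phi x - g n x)%:C *: u x + (g n x)%:C *: (u x - s n x).
      by rewrite rmorphB scalerBl scalerBr addrA subrK.
    by apply: le_trans (ler_rnormD _ _) _; rewrite !rnormZr.
  - exact: cvg_cst.
  - rewrite -[X in _ --> X](addr0 0) -[X in X + _](mul0r (rnorm (u x))).
    rewrite -[X in _ + X](mulr0 `|phi x|).
    apply: cvgD; apply: cvgM => //; first 1 last.
    + exact: cvg_cst.
    + by apply: cvg_norm.
    + rewrite -(normr0 R) -(subrr (phi x)); apply: cvg_norm.
      by apply: cvgB => //; exact: cvg_cst.
have -> : w n @^-1` [set y] = \bigcup_(z in range (s n))
    (s n @^-1` [set z] `&` g n @^-1` [set c | c%:C *: z = y]).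
  apply/seteqP; split => [x /= wy|x [z _ /= [<- <-]]//].
  by exists (s n x) => //; exists x.
apply: fin_bigcup_measurable; first exact: fimfunP.
move=> z _; apply: measurableI; first exact: ms.
apply: (@fimfun_preimage_measurable _ (g n)) => c.
exact: measurable_sfunP (measurable_set1 c).
Qed.

End strong_measurability.

Section bochner_ae.
Context d (T : measurableType d) (R : realType) (mu : {measure set T -> \bar R}).
Context (H : normedModType R[i]) (p : R) (p1 : 1 <= p).
Implicit Types f g : bochner mu H p1.

Lemma bochner_repr0 : bochner_repr (0 : bochner mu H p1) = 0 %[ae mu].
Proof.
have := bochner_reprZ 0 (0 : bochner mu H p1); rewrite scale0r.
by apply: filterS => x /(_ I) -> _; exact: scale0r.
Qed.

Lemma bochner_ae_inj f g : bochner_repr f = bochner_repr g %[ae mu] -> f = g.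
Proof. by move=> fg; rewrite -[f]reprK -[g]reprK; exact/bochner_piP. Qed.

End bochner_ae.

(** * The unit ball of Lp inside L2 and its dual norm *)

Section L2_Lp_ball.
Context d (T : measurableType d) (R : realType) (mu : {measure set T -> \bar R}).
Context (H : hilbertType R) (p : R) (p1 : 1 < p).
Implicit Types (f g h : L2 mu H) (u : T -> H).

Local Notation ball := (L2_Lp_ball (mu := mu) (H := H) (ltW p1)).
Local Notation ip x y := (complex.Re (inner x y)).
Let hi := @hilbert_real_inner R H.
Let hb := real_inner_bil hi.
Let Lb := real_inner_bil (@L2_real_inner _ T R mu H).

Let q := p / (p - 1).

Let p0 : 0 < p. Proof. exact: lt_trans p1. Qed.

Let q0 : 0 < q. Proof. by rewrite divr_gt0// subr_gt0. Qed.

Let pq : p^-1 + q^-1 = 1.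
Proof. by rewrite /q invf_div; field; rewrite gt_eqF. Qed.

Lemma L2_bochner_normZ f (c : R) : 0 <= c ->
  bochner_norm mu p (bochner_repr (c%:C *: f)) = (c%:E * bochner_norm mu p f)%E.
Proof.
move=> c0; have sf := L2_strongly_measurable f.
have scf : strongly_measurable (c%:C *: bochner_repr f).
  rewrite -[_ *: _]addr0; apply: strongly_measurableP => //.
  exact: strongly_measurable0.
rewrite (eq_bochner_norm p (L2_strongly_measurable _) scf (bochner_reprZ _ _)).
rewrite bochner_normZ ?(ltW p1)//; congr (_%:E * _)%E.
by rewrite normc_def/= expr0n/= addr0 sqrtr_sqr ger0_norm.
Qed.

Lemma L2_bochner_normD f g :
  (bochner_norm mu p (bochner_repr (f + g)%R) <= bochner_norm mu p f + bochner_norm mu p g)%E.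
Proof.
have sf := L2_strongly_measurable f; have sg := L2_strongly_measurable g.
rewrite (eq_bochner_norm p (L2_strongly_measurable _)
  (strongly_measurableD sf sg) (bochner_reprD f g)).
exact: (ler_bochner_normD mu (ltW p1) sf sg).
Qed.

Lemma L2_Lp_ballP f : ball f <-> (bochner_norm mu p f <= 1)%E.
Proof.
split=> [[]//|f1]; split=> //; rewrite /L2_cap_Lp/= inE; split.
  exact: L2_strongly_measurable.
by apply: le_lt_trans f1 _; rewrite ltry.
Qed.

Lemma L2_Lp_ball_Rintegral f : ball f ->
  rintegrable mu (fun x => rnorm (f x) `^ p) /\ \int[mu]_x (rnorm (f x) `^ p) <= 1.
Proof.
move=> [+ f1]; rewrite /L2_cap_Lp/= inE => -[sf ff].
have fi := (bochner_norm_fin mu p0 sf).1 ff.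
by split=> //; rewrite -bochner_norm_le1.
Qed.

Lemma L2_Lp_ball_ae f u : bochner_repr f = u %[ae mu] -> strongly_measurable u ->
  rintegrable mu (fun x => rnorm (u x) `^ p) ->
  \int[mu]_x (rnorm (u x) `^ p) <= 1 -> ball f.
Proof.
move=> fu su ui u1; apply/L2_Lp_ballP.
rewrite (eq_bochner_norm p (L2_strongly_measurable f) su fu).
by rewrite bochner_norm_le1.
Qed.

Lemma L2_Lp_ball0 : ball 0.
Proof.
apply/L2_Lp_ballP; rewrite (eq_bochner_norm p (L2_strongly_measurable _)
  (strongly_measurable0 _ _) (bochner_repr0 _ _ _)) bochner_norm0 ?(ltW p1)//.
Qed.

Lemma L2_Lp_ball_convex f g (t : R) : ball f -> ball g -> 0 <= t -> t <= 1 ->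
  ball (t%:C *: f + (1 - t)%:C *: g).
Proof.
move=> /L2_Lp_ballP f1 /L2_Lp_ballP g1 t0 t1; apply/L2_Lp_ballP.
have t1' : 0 <= 1 - t by rewrite subr_ge0.
apply: le_trans (L2_bochner_normD _ _) _; rewrite !L2_bochner_normZ//.
apply: (@le_trans _ _ (t%:E * 1 + (1 - t)%:E * 1)%E).
  by apply: leeD; apply: lee_wpmul2l; rewrite ?lee_fin.
by rewrite !mule1 -EFinD lee_fin subrKC.
Qed.

Lemma L2_of_strongly_measurable u : strongly_measurable u ->
  rintegrable mu (fun x => rnorm (u x) ^+ 2) ->
  exists f, bochner_repr f = u %[ae mu].
Proof.
move=> su ui.
have up : u \in p_integrable mu (le1_2 R).
  rewrite inE; split=> //; apply/(bochner_norm_fin mu (ltr0n _ 2) su).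
  by apply: eq_integrable ui => // x _ /=; rewrite powR_mulrn ?rnorm_ge0.
exists (\pi_(bochner mu H (le1_2 R)) (BochnerFun up))%qT.
exact: bochner_repr_pi.
Qed.

Lemma rintegrable_rnorm_powR_ae f u (s : R) : bochner_repr f = u %[ae mu] ->
  strongly_measurable u ->
  rintegrable mu (fun x => rnorm (u x) `^ s) ->
  rintegrable mu (fun x => rnorm (f x) `^ s).
Proof.
move=> fu su; apply: rintegrable_ae.
  by apply: measurable_rnorm_powR; exact: L2_strongly_measurable.
by apply: filterS fu => x /(_ I) -> _.
Qed.

(** Integrate Young's inequality: the [q]-th power of [|w|] is [|f|^p], so both integrals are at
    most 1 and the bound is [1 / p + 1 / q]. This will identify [f] as the projection of [f + w]. *)
Lemma L2_rinner_duality_le1 (w f g : L2 mu H) :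
  bochner_repr w = (fun x => duality_map p (bochner_repr f x)) %[ae mu] ->
  rintegrable mu (fun x => rnorm (f x) `^ p) -> \int[mu]_x (rnorm (f x) `^ p) <= 1 ->
  ball g -> L2_rinner w g <= 1.
Proof.
move=> wf fi f1 /L2_Lp_ball_Rintegral[gi g1].
have wfq : (fun x => rnorm (w x) `^ q) = (fun x => rnorm (f x) `^ p) %[ae mu].
  by apply: filterS wf => x /(_ I) -> _; rewrite (rnorm_duality_map_powR p0 q0 pq).
have mw := measurable_rnorm_powR q (L2_strongly_measurable w).
have wi := rintegrable_ae mw wfq fi.
have := ae_eq_Rintegral mw (rintegrable_measurable fi) wfq => wE.
have gpi := rintegrableZ p^-1 gi; have wqi := rintegrableZ q^-1 wi.
apply: (@le_trans _ _ (\int[mu]_x (p^-1 * rnorm (g x) `^ p + q^-1 * rnorm (w x) `^ q))).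
  apply: (le_Rintegral measurableT (rintegrable_inner w g) (rintegrableD gpi wqi)).
  move=> x _; apply: le_trans (inner_young p0 q0 pq _ _) _.
  by rewrite /= ![_^-1 * _]mulrC.
rewrite (RintegralD measurableT gpi wqi) (RintegralZl _ measurableT gi).
rewrite (RintegralZl _ measurableT wi) wE -[leRHS]pq.
by apply: lerD; rewrite ler_piMr ?invr_ge0 ?(ltW p0) ?(ltW q0).
Qed.

(** The cut at [n] keeps the product of [theta n |g|] and [g] in [L_2]. The value at [s = 0] is
    harmless because [theta] is always multiplied by a positive power of [s]. *)
Let theta (n : nat) (s : R) := Order.min (s `^ (q - 2)) n%:R.

Let theta_ge0 n s : 0 <= theta n s.
Proof. by rewrite le_min powR_ge0 ler0n. Qed.

Let theta_sqr_ge0 n s : 0 <= theta n s * s ^+ 2.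
Proof. exact: mulr_ge0 (theta_ge0 n s) (sqr_ge0 s). Qed.

Let theta_le n s : theta n s <= n%:R.
Proof. by rewrite ge_min lexx orbT. Qed.

(** Bound [p - 1] of the [p] factors [theta] by [s^(q-2)]; the exponents then add up to
    [(q - 2) (p - 1) + p = 2]. Thus the [p]-th power of the norm of the test function is at most its
    pairing with [g]. *)
Let theta_pow n s : 0 <= s -> theta n s `^ p * s `^ p <= theta n s * s ^+ 2.
Proof.
rewrite le_eqVlt => /predU1P[<-|s0].
  by rewrite powR0 ?gt_eqF// mulr0 expr0n/= mulr0.
rewrite -(mulr_powRB1 (theta_ge0 n s) p0) -mulrA ler_wpM2l//.
have p10 : 0 <= p - 1 by rewrite subr_ge0 ltW.
have : theta n s `^ (p - 1) <= (s `^ (q - 2)) `^ (p - 1).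
  by rewrite ge0_ler_powR// ?nnegrE ?powR_ge0// ge_min lexx.
have sp : 0 <= s `^ p by exact: powR_ge0.
move=> /(ler_wpM2r sp) /le_trans; apply.
rewrite -powRrM -powRD; last by rewrite (gt_eqF s0) implybT.
have -> : (q - 2) * (p - 1) + p = 2%:R.
  by have := conjugate_exponentM p0 q0 pq; lra.
by rewrite powR_mulrn// ltW.
Qed.

Let theta_lim (s : R) : 0 <= s ->
  limn (fun n => (theta n s * s ^+ 2)%:E) = (s `^ q)%:E.
Proof.
rewrite le_eqVlt => /predU1P[<-|s0].
  rewrite powR0 ?gt_eqF//; apply: lim_near_cst => //; apply: nearW => n.
  by rewrite expr0n/= mulr0.
apply: lim_near_cst => //.
exists (truncn (s `^ (q - 2))).+1 => // n /= sn.
rewrite /theta; have -> : Order.min (s `^ (q - 2)) n%:R = s `^ (q - 2).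
  apply/min_idPl; apply: (@le_trans _ _ (truncn (s `^ (q - 2))).+1%:R).
    exact/ltW/truncnS_gt.
  by rewrite ler_nat.
rewrite -powR_mulrn ?(ltW s0)// -powRD; last by rewrite (gt_eqF s0) implybT.
by rewrite subrK.
Qed.

Let theta_nd (s : R) m n : (m <= n)%N -> theta m s <= theta n s.
Proof.
by move=> mn; rewrite le_min !ge_min lexx/= ler_nat mn orbT.
Qed.

Let theta_int g n : rintegrable mu (fun x => theta n (rnorm (g x)) * rnorm (g x) ^+ 2).
Proof.
apply: rintegrable_le (rintegrableZ n%:R (L2_rintegrable g)).
  apply: measurable_funM; last by apply: rintegrable_measurable (L2_rintegrable g).
  apply: measurable_minr => //.
  by apply: measurable_rnorm_powR; exact: L2_strongly_measurable.
by move=> x; rewrite ger0_norm ?theta_sqr_ge0// ler_wpM2r ?sqr_ge0 ?theta_le.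
Qed.

(* [theta n |g| g] approximates [|g|^(q-2) g], the function that realizes the
   [L_q] norm of [g], by elements of [L_2] and [L_p]. *)
Let test g n : exists f : L2 mu H, [/\
  rintegrable mu (fun x => rnorm (f x) `^ p),
  \int[mu]_x (rnorm (f x) `^ p) <= \int[mu]_x (theta n (rnorm (g x)) * rnorm (g x) ^+ 2) &
  L2_rinner g f = \int[mu]_x (theta n (rnorm (g x)) * rnorm (g x) ^+ 2)].
Proof.
pose u x : H := (theta n (rnorm (g x)))%:C *: g x.
have sg := L2_strongly_measurable g.
have su : strongly_measurable u.
  apply: strongly_measurableZ => //; apply: measurable_minr => //.
  exact: measurable_rnorm_powR.
have un x : rnorm (u x) = theta n (rnorm (g x)) * rnorm (g x).
  by rewrite rnormZr ger0_norm ?theta_ge0.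
have u2 : rintegrable mu (fun x => rnorm (u x) ^+ 2).
  apply: rintegrable_le (rintegrableZ (n%:R ^+ 2) (L2_rintegrable g)).
    by apply: measurable_funX; exact: measurable_normf.
  move=> x; rewrite ger0_norm ?sqr_ge0// un exprMn ler_wpM2r ?sqr_ge0//.
  by rewrite lerXn2r ?nnegrE ?theta_ge0 ?theta_le.
have up_le x : rnorm (u x) `^ p <= theta n (rnorm (g x)) * rnorm (g x) ^+ 2.
  by rewrite un powRM ?rnorm_ge0// theta_pow ?rnorm_ge0.
have up : rintegrable mu (fun x => rnorm (u x) `^ p).
  apply: rintegrable_le (theta_int g n); first exact: measurable_rnorm_powR.
  by move=> x; rewrite ger0_norm ?powR_ge0.
have [f fu] := L2_of_strongly_measurable su u2; exists f; split.
- exact: rintegrable_rnorm_powR_ae fu su up.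
- rewrite (@ae_eq_Rintegral _ _ _ mu _ (fun x => rnorm (u x) `^ p)).
  + by apply: (le_Rintegral measurableT up (theta_int g n)) => x _; exact: up_le.
  + by apply: measurable_rnorm_powR; exact: L2_strongly_measurable.
  + exact: measurable_rnorm_powR.
  + by apply: filterS fu => x /(_ I) -> _.
- rewrite (L2_rinner_ae sg su) //; last exact: nearW.
  by apply: eq_Rintegral => x _; rewrite (rbZr hb) (real_innerxx hi).
Qed.

(** Converse of Hölder's inequality: the normalized test functions bound the truncated integrals
    [J n] by [m^q], and monotone convergence removes the truncation. *)
Lemma L2_rinner_bounded_Lq g (m : R) : 0 <= m ->
  (forall h, ball h -> L2_rinner g h <= m) ->
  rintegrable mu (fun x => rnorm (g x) `^ q) /\
  \int[mu]_x (rnorm (g x) `^ q) <= m `^ q.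
Proof.
move=> m0 gm.
pose J n := \int[mu]_x (theta n (rnorm (g x)) * rnorm (g x) ^+ 2).
have J_le n : J n <= m `^ q.
  have J0 : 0 <= J n by apply: Rintegral_ge0 => x _; rewrite theta_sqr_ge0.
  have [->|Jn0] := eqVneq (J n) 0; first exact: powR_ge0.
  have {Jn0}Jp : 0 < J n by rewrite lt_neqAle eq_sym Jn0.
  have [f [fi fJ gf]] := test g n; rewrite -/(J n) in fJ gf.
  (* The integral of [|f|^p] is at most [J n], so this factor brings [f] into the ball, while the
     pairing becomes [c * J n], the power [1 / q] of [J n]. *)
  pose c := J n `^ (- p^-1).
  have c0 : 0 < c by exact: powR_gt0.
  have cp : c `^ p = (J n)^-1.
    by rewrite -powRrM mulNr mulVf ?gt_eqF// powR_inv1.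
  have : L2_rinner g (c%:C *: f) <= m.
    apply: gm; apply: (@L2_Lp_ball_ae _ (c%:C *: bochner_repr f)).
    - exact: bochner_reprZ.
    - apply: (@strongly_measurableZ _ _ _ _ (fun=> c)) => //.
      exact: L2_strongly_measurable.
    - apply: eq_integrable (rintegrableZ (c `^ p) fi) => // x _ /=.
      by rewrite rnormZr gtr0_norm// powRM ?rnorm_ge0// ltW.
    - rewrite (@eq_Rintegral _ _ _ mu _ (fun x => c `^ p * rnorm (f x) `^ p)).
        by rewrite RintegralZl// cp ler_pdivrMl// mulr1.
      by move=> x _; rewrite rnormZr gtr0_norm// powRM ?rnorm_ge0// ltW.
  rewrite (rbZr Lb) gf => cJ.
  have E : c * J n = J n `^ (q^-1).
    rewrite /c -{2}(powRr1 J0) -powRD; last by rewrite (gt_eqF Jp) implybT.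
    by rewrite -pq addrA addNr add0r.
  rewrite E in cJ.
  have := ge0_ler_powR (ltW q0) (powR_ge0 _ _) m0 cJ.
  by rewrite -powRrM mulVf ?gt_eqF// powRr1.
have I_le : (\int[mu]_x (rnorm (g x) `^ q)%:E <= (m `^ q)%:E)%E.
  have -> : (\int[mu]_x (rnorm (g x) `^ q)%:E =
      \int[mu]_x limn (fun n => (theta n (rnorm (g x)) * rnorm (g x) ^+ 2)%:E))%E.
    by apply: eq_integral => x _; rewrite theta_lim ?rnorm_ge0.
  rewrite monotone_convergence//.
  - apply: lime_le.
      apply: ereal_nondecreasing_is_cvgn => n k nk; apply: ge0_le_integral => //.
      + by move=> x _; rewrite lee_fin theta_sqr_ge0.
      + by apply/measurable_EFinP; exact: rintegrable_measurable (theta_int g n).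
      + by apply/measurable_EFinP; exact: rintegrable_measurable (theta_int g k).
      + by move=> x _; rewrite lee_fin ler_wpM2r ?sqr_ge0// theta_nd.
    apply: nearW => n; rewrite -[leLHS]fineK; last exact: integrable_fin_num (theta_int g n).
    by rewrite lee_fin; exact: J_le.
  - by move=> n; apply/measurable_EFinP; exact: rintegrable_measurable (theta_int g n).
  - by move=> n x _; rewrite lee_fin theta_sqr_ge0.
  - by move=> x _ n k nk; rewrite lee_fin ler_wpM2r ?sqr_ge0// theta_nd.
have gi : rintegrable mu (fun x => rnorm (g x) `^ q).
  apply/integrableP; split.
    apply/measurable_EFinP; apply: measurable_rnorm_powR.
    exact: L2_strongly_measurable.
  under eq_integral do rewrite /= ger0_norm ?powR_ge0//.
  by apply: le_lt_trans I_le _; rewrite ltry.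
split=> //; rewrite -lee_fin /Rintegral fineK//; exact: integrable_fin_num.
Qed.

Lemma L2_rinner_max_duality f g : ball f ->
  (forall h, ball h -> L2_rinner g h <= L2_rinner g f) ->
  exists2 c : R, 0 <= c &
    bochner_repr g = (fun x => c%:C *: duality_map p (bochner_repr f x)) %[ae mu].
Proof.
move=> f1 gf; pose m := L2_rinner g f.
have m0 : 0 <= m by have := gf _ L2_Lp_ball0; rewrite (rlinear0 (Lb.2 g)).
have [gi gm] := L2_rinner_bounded_Lq m0 gf.
exists m => //.
(* For [m = 0] the bound in [L_q] already gives [g = 0], so [c = m] is the right factor in both
   cases. *)
have [m00|mn0] := eqVneq m 0.
  have : (fun x => rnorm (g x) `^ q) = cst 0 %[ae mu].
    apply: Rintegral_ge0_eq0 => // [x|]; first exact: powR_ge0.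
    by rewrite m00 powR0 ?gt_eqF// in gm.
  apply: filterS => x /(_ I) /powR_eq0_eq0 /rnorm0_eq0 gx _.
  by rewrite gx m00 scale0r.
have {mn0}mp : 0 < m by rewrite lt_neqAle eq_sym mn0.
have [fi fle] := L2_Lp_ball_Rintegral f1.
have mq : 0 < m `^ q by exact: powR_gt0.
(* [D] is the Young defect of [g / m] against [f]: nonnegative, with integral at most
   [1 / p + 1 / q - 1 = 0], hence zero almost everywhere. *)
pose D x := p^-1 * rnorm (f x) `^ p + (q^-1 / m `^ q) * rnorm (g x) `^ q
  - m^-1 * ip (g x) (f x).
have i1 := rintegrableZ p^-1 fi; have i2 := rintegrableZ (q^-1 / m `^ q) gi.
have i3 := rintegrableZ m^-1 (rintegrable_inner g f).
have i12 := rintegrableD i1 i2.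
have mVq : m^-1 `^ q = (m `^ q)^-1.
  by rewrite -(powR_inv1 m0) -powRrM mulN1r powRN.
have DE x : D x = rnorm (f x) `^ p / p + rnorm ((m^-1)%:C *: g x) `^ q / q
    - ip ((m^-1)%:C *: g x) (f x).
  rewrite /D rnormZr ger0_norm ?invr_ge0// powRM ?rnorm_ge0 ?invr_ge0//.
  rewrite mVq (rbZl hb); field.
  by rewrite !gt_eqF.
have D0 x : 0 <= D x by rewrite DE subr_ge0; exact: inner_young.
have Di : rintegrable mu D by exact: (integrableB measurableT i12 i3).
have ID : \int[mu]_x D x <= 0.
  rewrite /D (RintegralB measurableT i12 i3) (RintegralD measurableT i1 i2).
  rewrite (RintegralZl _ measurableT fi) (RintegralZl _ measurableT gi).
  rewrite (RintegralZl _ measurableT (rintegrable_inner g f)) -L2_rinnerE -/m mulVf ?gt_eqF//.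
  rewrite subr_le0 -[leRHS]pq; apply: lerD.
    by rewrite ler_piMr ?invr_ge0 ?(ltW p0).
  by rewrite -mulrA ler_piMr ?invr_ge0 ?(ltW q0)// ler_pdivrMl// mulr1.
have := Rintegral_ge0_eq0 Di D0 ID.
apply: filterS => x /(_ I) Dx _.
have : (m^-1)%:C *: g x = duality_map p (f x).
  apply: (inner_young_eq p0 q0 pq); rewrite -subr_le0 -DE.
  by rewrite Dx.
by move=> <-; rewrite scalerA -rmorphM mulfV ?gt_eqF// scale1r.
Qed.

End L2_Lp_ball.

(** * The theorem *)

Section real_norm_topology.
Context (R : realType) (X : normedModType R[i]).

Lemma cvg_rnormP (I : Type) (F : set_system I) {FF : Filter F} (f : I -> X) (y : X) :
  f t @[t --> F] --> y <->
  forall e : R, 0 < e -> \forall t \near F, rnorm (f t - y) < e.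
Proof.
split=> [/cvgrPdist_lt fy e e0|fy].
  have e0' : 0 < e%:C :> R[i] by rewrite ltcR.
  by apply: filterS (fy _ e0') => t; rewrite -rnormE ltcR rnormB.
apply/cvgrPdist_lt => e e0.
have re0 : 0 < complex.Re e by move: e0; rewrite ltcE/= => /andP[].
apply: filterS (fy _ re0) => t; rewrite rnormB => ft.
by rewrite -rnormE -[e]RRe_real ?ltcR// realE ltW.
Qed.

Lemma dense_rnorm (A : set X) x (e : R) : dense A -> 0 < e ->
  exists2 y, A y & rnorm (x - y) < e.
Proof.
move=> dA e0; have e0' : 0 < e%:C :> R[i] by rewrite ltcR.
have ne : (ball x e%:C)^° !=set0 by exists x; exact: nbhsx_ballx.
have [y [/interior_subset]] := dA _ ne (@open_interior _ _).
by rewrite -ball_normE/= -rnormE ltcR => xy Ay; exists y.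
Qed.

Lemma continuous_rnorm_bounded (Y : normedModType R[i]) (f : X -> Y) :
  continuous f -> (forall (c : R) x, f (c%:C *: x) = c%:C *: f x) ->
  exists C : R, forall x, rnorm (f x) <= C * rnorm x.
Proof.
move=> cf fZ.
have f0 : f 0 = 0 by have := fZ 0 0; rewrite scaler0 scale0r.
have := cf 0; rewrite /continuous_at f0 => /cvgrPdist_lt.
have e0' : 0 < 1%:C :> R[i] by rewrite ltcR.
move=> /(_ _ e0') /nbhs_ballP[d /= d0 dP].
have rd0 : 0 < complex.Re d by move: d0; rewrite ltcE/= => /andP[].
have dE : d = (complex.Re d)%:C by rewrite RRe_real// realE ltW.
exists (2 / complex.Re d) => x.
have [->|x0] := eqVneq x 0; first by rewrite f0 !rnorm0 mulr0.
have {}x0 : 0 < rnorm x.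
  by rewrite lt_neqAle rnorm_ge0 andbT eq_sym; apply: contra x0 => /eqP/rnorm0_eq0 ->.
have c0 : 0 < complex.Re d / 2 / rnorm x by rewrite !divr_gt0.
have : ball 0 d ((complex.Re d / 2 / rnorm x)%:C *: x).
  rewrite -ball_normE/= sub0r normrN -rnormE rnormZr gtr0_norm//.
  by rewrite divfK ?gt_eqF// dE ltcR ltr_pdivrMr//; lra.
move=> /dP; rewrite sub0r normrN -rnormE ltcR fZ rnormZr gtr0_norm// => H.
have {}H : complex.Re d / 2 * rnorm (f x) < 1 * rnorm x.
  by rewrite -ltr_pdivrMr// mulrAC.
by rewrite mulrAC ler_pdivlMr//; lra.
Qed.

Lemma generatorP (S : R -> X -> X) x y : generator S (x, y) <-> derivative_at0 S x y.
Proof.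
rewrite /generator/= cvg_rnormP; split=> h e e0.
  have := h e e0; rewrite !near_right0P => -[d d0 dP]; exists d => // t t0 td.
  have := dP t t0 td.
  have -> : S t x - x - t%:C *: y = t%:C *: (t^-1%:C *: (S t x - x) - y).
    by rewrite scalerBr scalerA -rmorphM mulfV ?gt_eqF// scale1r.
  by rewrite rnormZr gtr0_norm// ler_pM2l// => /ltW.
have e20 : 0 < e / 2 by rewrite divr_gt0.
have := h _ e20; rewrite !near_right0P => -[d d0 dP]; exists d => // t t0 td.
have := dP t t0 td.
have -> : t^-1%:C *: (S t x - x) - y = t^-1%:C *: (S t x - x - t%:C *: y).
  by rewrite [in RHS]scalerBr scalerA -rmorphM mulVf ?gt_eqF// scale1r.
rewrite rnormZr gtr0_norm ?invr_gt0// => H.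
by rewrite ltr_pdivrMl//; apply: le_lt_trans H _; rewrite ltr_pM2l//; lra.
Qed.

End real_norm_topology.

Theorem theorem1p1 (R : realType) (d : measure_display) (T : measurableType d)
  (mu : {sigma_finite_measure set T -> \bar R}) (H : hilbertType R)
  (p : R) (p1 : 1 < p)
  (P : L2 mu H -> L2 mu H)
  (projP : orthogonal_projection (L2_Lp_ball (mu := mu) (H := H) (ltW p1)) P)
  (V : hilbertType R) (j : {linear V -> L2 mu H}) (j_emb : dense_embedding j)
  (a : {sesquilinear V})
  (a_cont : continuous_form a) (a_ell : elliptic_form j a)
  (S : R -> L2 mu H -> L2 mu H)
  (S_gen : generates (opp_operator (form_operator j a)) S) :
  (forall (u : L2 mu H) (t : R), L2_cap_Lp (ltW p1) u -> 0 < t ->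
     (bochner_norm mu p (S t u) <= bochner_norm mu p u)%E)
  <->
  (P @` range j `<=` range j /\
   forall u w : V, bochner_repr (j w) = normf_pow_sgnf p (bochner_repr (j u)) %[ae mu] ->
     0 <= complex.Re (a u w)).
Proof.
have [j_inj j_cont j_dense] := j_emb.
have [M M0 aM] := a_cont.
have [kappa [omega [kappa0 a_kappa]]] := a_ell.
have [[S_linear S_continuous S_semi S_right] S_generator] := S_gen.
pose al u v := complex.Re (a u v).
pose b := @L2_rinner _ T R mu H.
have bi : real_inner b := L2_real_inner mu H.
have bb := real_inner_bil bi.
have bVi := @hilbert_real_inner R V.
have al_bil : rbilinear al := sesquilinear_rbilinear a.
have [Mj j_le] : exists C : R, forall v, rnorm (j v) <= C * rnorm v.
  by apply: continuous_rnorm_bounded => // c v; rewrite linearZ.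
have j_dense' x (e : R) : 0 < e -> exists v, rnorm (x - j v) < e.
  by move=> e0; have [_ [v _ <-] xv] := dense_rnorm x j_dense e0; exists v.
have al_bd : rbibounded al M.
  move=> u v; rewrite -lecR !rmorphM/= !rnormE.
  exact: le_trans (normc_ge_Re _) (aM u v).
(* Ellipticity allows a negative [omega]; enlarging it to a nonnegative one keeps the inequality. *)
have omega0 : 0 <= Order.max omega 0 by rewrite le_max lexx orbT.
have al_ell u : kappa * rnorm u ^+ 2 <= al u u + Order.max omega 0 * rnorm (j u) ^+ 2.
  apply: le_trans (a_kappa u) _; rewrite lerD2l ler_wpM2r ?sqr_ge0//.
  by rewrite le_max lexx.
have S_lin (t c : R) x y : 0 < t -> S t (c%:C *: x + y) = c%:C *: S t x + S t y.
  by move=> t0; rewrite S_linear.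
have S_Z (t c : R) x : 0 < t -> S t (c%:C *: x) = c%:C *: S t x.
  move=> t0; have St0 : S t 0 = 0.
    by have := S_lin t (-1) 0 0 t0; rewrite scaler0 addr0 rmorphN rmorph1 scaleN1r addNr.
  by have := S_lin t c x 0 t0; rewrite !addr0 St0 addr0.
have S_bd (t : R) : 0 < t -> exists C, forall x, rnorm (S t x) <= C * rnorm x.
  move=> t0; apply: continuous_rnorm_bounded; first exact: S_continuous.
  by move=> c x; exact: S_Z.
have S_add (s t : R) x : 0 < s -> 0 < t -> S (s + t) x = S s (S t x).
  by move=> s0 t0; rewrite S_semi.
have S_cvg x (e : R) : 0 < e -> \forall t \near 0^'+, rnorm (S t x - x) < e.
  exact: (cvg_rnormP _ _).1 (S_right x) e.
have S_der x y : derivative_at0 S x y <->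
    exists2 u, j u = x & forall v, al u v = - b y (j v).
  rewrite -generatorP S_generator; split=> [[[x' y'] [u /= ju uP] [<- <-]]|[u ju uP]].
    by exists u => // v; rewrite (rbNl bb) opprK /al uP.
  exists (x, - y); last by rewrite /= opprK.
  exists u => //= v; apply/eqP; rewrite eq_complex; apply/andP; split; apply/eqP.
    by rewrite -/(al u v) uP -(rbNl bb).
  (* The imaginary part of the equation at [v] is its real part at ['i *: v]. *)
  by rewrite sesquilinear_im L2_inner_im -linearZ -/(al u _) uP -(rbNl bb).
pose C := L2_Lp_ball (mu := mu) (H := H) (ltW p1).
have C_convex := L2_Lp_ball_convex (mu := mu) (H := H) (p1 := p1).
have P_in x : C (P x).
  have : closest C x (P x) by rewrite projP.
  by case.
have P_le x y : C y -> rnorm (x - P x) <= rnorm (x - y).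
  move=> Cy; have [_ /(_ y Cy)] : closest C x (P x) by rewrite projP.
  by rewrite -!rnormE lecR.
have P_uniq x y : C y -> (forall h, C h -> b (x - y) (h - y) <= 0) -> P x = y.
  move=> Cy ob; suff : closest C x y by rewrite projP.
  split=> // h Ch; rewrite -!rnormE lecR.
  rewrite -(ler_pXn2r (n := 2))// ?nnegrE ?rnorm_ge0//.
  have -> : x - h = (x - y) - (h - y) by rewrite opprB addrA subrK.
  by rewrite (rnormB_sqr bi (x - y)); have := ob h Ch; have := sqr_ge0 (rnorm (h - y)); lra.
have S_contractive : (forall (u : L2 mu H) (t : R), L2_cap_Lp (ltW p1) u -> 0 < t ->
     (bochner_norm mu p (S t u) <= bochner_norm mu p u)%E) <->
     (forall (t : R) x, 0 < t -> C x -> C (S t x)).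
  split=> [Sle t x t0 [xp x1]|SC u t up t0].
    by apply/L2_Lp_ballP; exact: le_trans (Sle x t xp t0) x1.
  have uy : (bochner_norm mu p u < +oo)%E.
    by move: up; rewrite /L2_cap_Lp/= inE => -[].
  apply/lee_addgt0Pr => e e0.
  have ufin : bochner_norm mu p u \is a fin_num by rewrite ge0_fin_numE// Lnorm_ge0.
  (* Ball invariance gives contractivity by homogeneity; dividing by the norm plus [e] stays
     meaningful when the norm is 0. *)
  rewrite -(fineK ufin) -EFinD; set s := fine _ + e.
  have s0 : 0 < s by rewrite ltr_wpDl// fine_ge0// Lnorm_ge0.
  have : C (s^-1%:C *: u).
    apply/L2_Lp_ballP; rewrite L2_bochner_normZ// ?invr_ge0 ?(ltW s0)//.
    rewrite -(fineK ufin) -EFinM lee_fin ler_pdivrMl// mulr1.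
    by rewrite lerDl ltW.
  move=> /(SC t _ t0); rewrite S_Z// => /L2_Lp_ballP.
  rewrite L2_bochner_normZ// ?invr_ge0 ?(ltW s0)//.
  by rewrite lee_pdivrMl// mule1.
have S_form : (forall (t : R) x, 0 < t -> C x -> C (S t x)) <->
    forall u, exists2 v, j v = P (j u) & 0 <= al v (u - v).
  split=> [SC u|formP t x].
    exact: (invariant_form bi bVi j_le j_dense' al_bil al_bd kappa0 omega0 al_ell
      S_lin S_bd S_add S_cvg S_der C_convex P_in P_le u SC).
  exact: (form_invariant bi bVi j_le j_dense' al_bil al_bd kappa0 omega0 al_ell
      S_lin S_bd S_add S_cvg S_der C_convex P_in P_le formP).
have jE u v : j u = j v -> u = v by exact: j_inj.
rewrite S_contractive S_form; split=> [formP|[PV aP] u]; last first.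
  have [v _ jv] : range j (P (j u)) by apply: PV; exists (j u).
  exists v => //.
  have max_v h : C h -> b (j u - P (j u)) h <= b (j u - P (j u)) (P (j u)).
    move=> Ch; have := projection_obtuse bi C_convex P_in P_le (j u) Ch.
    by rewrite (rbBr bb) subr_le0.
  have [c c0 uP] := L2_rinner_max_duality (P_in (j u)) max_v.
  have uv : bochner_repr (j (u - v)) =
      (fun x => c%:C *: duality_map p (bochner_repr (j v) x)) %[ae mu].
    by rewrite linearB/= jv.
  have [cz|cn0] := eqVneq c 0.
    have -> : u - v = 0.
      apply: jE; rewrite linear0; apply: bochner_ae_inj.
      have := bochner_repr0 mu H (le1_2 R).
      by apply: filterS2 uv => x /(_ I) -> /(_ I) -> _; rewrite cz scale0r.
    by rewrite /al linear0r.
  have {cn0}cp : 0 < c by rewrite lt_neqAle eq_sym cn0.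
  (* The vector [c^-1 (u - v)] of [V] represents [|v|^(p-1) sgn v], so the hypothesis on the form
     applies to it. *)
  have : 0 <= al v (c^-1%:C *: (u - v)).
    apply: aP; rewrite linearZ/=.
    have := bochner_reprZ c^-1%:C (j (u - v)); apply: filterS2 uv => x /(_ I) uvx /(_ I) -> _.
    rewrite normf_pow_sgnfE -[LHS]/(c^-1%:C *: bochner_repr (j (u - v)) x) uvx.
    by rewrite scalerA -rmorphM mulVf ?gt_eqF// scale1r.
  by rewrite (rbZr al_bil) pmulr_rge0// invr_gt0.
split=> [_ [_ [u _ <-] <-]|u w jw].
  by have [v <- _] := formP u; exists v.
have jw' : bochner_repr (j w) = (fun x => duality_map p (bochner_repr (j u) x)) %[ae mu].
  by apply: filterS jw => x /(_ I) -> _; rewrite normf_pow_sgnfE.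
have sju := L2_strongly_measurable (j u).
have mup := measurable_rnorm_powR p sju.
have p0 : 0 < p := lt_trans ltr01 p1.
(* Membership of [j u] in [L_p] is derived: [|u|^p] is the pointwise inner product of two functions
   of [L_2], hence integrable. *)
have uwp : (fun x => rnorm (bochner_repr (j u) x) `^ p) =
    (fun x => complex.Re (inner (bochner_repr (j w) x) (bochner_repr (j u) x))) %[ae mu].
  by apply: filterS jw' => x /(_ I) -> _; rewrite (inner_duality_map p0).
have ui := rintegrable_ae mup uwp (rintegrable_inner _ _).
pose N := \int[mu]_x (rnorm (bochner_repr (j u) x) `^ p).
have bN : b (j w) (j u) = N.
  by rewrite /N (ae_eq_Rintegral mup (rintegrable_measurable (rintegrable_inner _ _)) uwp).
have N_ge0 : 0 <= N by apply: Rintegral_ge0 => x _; exact: powR_ge0.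
have [N0|N0] := eqVneq N 0.
  have u0 : u = 0.
    apply: jE; rewrite linear0; apply: bochner_ae_inj.
    have := bochner_repr0 mu H (le1_2 R).
    have := @Rintegral_ge0_eq0 _ _ _ mu _ ui (fun x => powR_ge0 _ _).
    rewrite -/N N0 => /(_ (lexx 0)).
    move=> A1 A2; apply: filterS2 A1 A2 => x /(_ I) /powR_eq0_eq0 /rnorm0_eq0 -> /(_ I) ->.
    by [].
  by rewrite u0 -/(al 0 w) (rlinear0 (al_bil.1 w)).
have {N_ge0}N0 : 0 < N by rewrite lt_neqAle eq_sym N0.
(* This scales [u] to norm 1 in [L_p]. The duality map is homogeneous of degree [p - 1], which
   dictates the factor in [w1]. *)
pose c := N `^ (- p^-1).
have c0 : 0 < c by exact: powR_gt0.
have cp0 : 0 < c `^ (p - 1) by exact: powR_gt0.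
have cpN : c `^ p * N = 1.
  by rewrite -powRrM mulNr mulVf ?gt_eqF// powR_inv1 ?(ltW N0)// mulVf// gt_eqF.
pose u1 := c%:C *: u; pose w1 := (c `^ (p - 1))%:C *: w.
have ju1 : bochner_repr (j u1) = (fun x => c%:C *: bochner_repr (j u) x) %[ae mu].
  by rewrite linearZ; exact: bochner_reprZ.
have jw1 : bochner_repr (j w1) =
    (fun x => duality_map p (bochner_repr (j u1) x)) %[ae mu].
  have := bochner_reprZ (c `^ (p - 1))%:C (j w); rewrite -linearZ => A1.
  apply: filterS3 A1 jw' ju1 => x /(_ I) A1 /(_ I) A2 /(_ I) A3 _.
  by rewrite A1 A3 duality_mapZ// -A2.
have Cu1 : C (j u1).
  apply: L2_Lp_ball_ae ju1 _ _ _.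
  - exact: (@strongly_measurableZ _ _ _ _ (fun=> c)).
  - apply: eq_integrable (rintegrableZ (c `^ p) ui) => // x _ /=.
    by rewrite rnormZr gtr0_norm// powRM ?rnorm_ge0// ltW.
  - rewrite (@eq_Rintegral _ _ _ mu _
      (fun x => c `^ p * rnorm (bochner_repr (j u) x) `^ p)).
      by rewrite RintegralZl// cpN.
    by move=> x _; rewrite rnormZr gtr0_norm// powRM ?rnorm_ge0// ltW.
have [ui1 u1_le] := L2_Lp_ball_Rintegral Cu1.
have bu1 : b (j w1) (j u1) = 1.
  rewrite !linearZ/= (rbZl bb) (rbZr bb) bN mulrA [_ * c]mulrC.
  by rewrite mulr_powRB1// ltW.
(* Pairing with [j w1] is at most 1 on the ball and equals 1 at [j u1]: the variational inequality
   for the projection of [j u1 + j w1]. The form condition at [u1 + w1] then reads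
   [0 <= al u1 w1]. *)
have Pu1 : P (j (u1 + w1)) = j u1.
  apply: P_uniq => // h Ch; rewrite linearD/= addrAC subrr add0r (rbBr bb) bu1 subr_le0.
  exact: L2_rinner_duality_le1 jw1 ui1 u1_le Ch.
have [v] := formP (u1 + w1); rewrite Pu1 => /jE ->.
by rewrite addrAC subrr add0r (rbZl al_bil) (rbZr al_bil) !pmulr_rge0.
Qed.
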